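(* Let $\theta>0$ and let $\gamma_t$ be the intensity measure of the point process of (location, weight) pairs of atoms of the Howitt–Warren process $\rho_t$ started from $\delta_0$ with characteristic measure $\frac\theta2\mathbf 1_{[0,1]}(x)dx$ and drift $0$, disintegrated as $\gamma_t(dy,dw)=\gamma_t(y,dw)\,dy$. For $x\in\mathbb{R}$ and $t>0$ let $\mu_{t,x}$ be the image under $w\mapsto\sqrt t\,w$ of the probability measure $\sqrt{2\pi t}\,e^{\frac{x^2}{2}}\,w\,\gamma_t(\sqrt t\,x,dw)$. Then for each $x\in\mathbb{R}$, as $t\to\infty$, $\mu_{t,x}$ converges weakly to the exponential distribution with rate $\theta\sqrt{2\pi}\,e^{\frac{x^2}{2}}$, i.e. to $\theta\sqrt{2\pi}\,e^{\frac{x^2}2}\,e^{-\theta\sqrt{2\pi}\,e^{x^2/2}\,w}\,dw$ on $(0,\infty)$.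
   Context: Howitt–Warren process. A stochastic flow of kernels on $\mathbb{R}$ is a family of random probability kernels $(K_{s,t}(x,dy))_{s\le t}$ (random transition probabilities satisfying the flow property) with independent increments ($K_{t_0,t_1},\dots,K_{t_{n-1},t_n}$ independent for $t_0<\dots<t_n$) and stationary ($K_{s,t}$ has law depending only on $t-s$). Its $n$-point motion is the Markov process on $\mathbb{R}^n$ with transition probabilities $\mathbb{P}(X_n(t)\in E\mid X_n(s)=x)=\mathbb{E}[\int_E\prod_{i=1}^nK_{s,t}(x_i,dy_i)]$. The Howitt–Warren flow with characteristic measure $\nu$ and drift $\beta$ is the stochastic flow of kernels whose $n$-point motions solve, for each $n$, the Howitt–Warren martingale problem (below) with these data. The Howitt–Warren process started from $\delta_0$ is $\rho_t(A)=K_{0,t}(0,A)$. It is known that for each fixed $t>0$, $\rho_t$ is a.s. purely atomic, $\rho_t=\sum_iw_i\delta_{y_i}$ with $w_i>0$ and distinct $y_i$. The intensity measure is $\gamma_t(A_1\times A_2)=\mathbb{E}\big[\sum_i\mathbf 1_{\{y_i\in A_1,\,w_i\in A_2\}}\big]$ for Borel $A_1\subset\mathbb{R}$, $A_2\subset(0,\infty)$. It has the form $\gamma_t(y,dw)\,dy$, and the moments satisfy, for all $n\ge1$ and a.e. $y$, $\int w^n\gamma_t(y,dw)=n^{-1}\theta^{1-n}u^{(n)}_t(0,(y,\dots,y))$, where $$u^{(n)}_t(x,y)=\frac{1}{(2\pi)^n}\int_{\mathbb{R}^n}e^{-\frac12 t|k|^2}\sum_{\sigma\in S_n}e^{ik_\sigma\cdot(x-y_\sigma)}\prod_{\alpha<\beta:\,\sigma(\beta)<\sigma(\alpha)}\frac{i\theta(k_{\sigma(\alpha)}-k_{\sigma(\beta)})+k_{\sigma(\beta)}k_{\sigma(\alpha)}}{i\theta(k_{\sigma(\alpha)}-k_{\sigma(\beta)})-k_{\sigma(\beta)}k_{\sigma(\alpha)}}\,dk,\qquad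 k_\sigma=(k_{\sigma(1)},\dots,k_{\sigma(n)}).$$ Convention: for each $t$, the finite measures $w\,\gamma_t(y,dw)$ on $[0,\infty)$ are taken to be the version of the disintegration for which these moment identities hold for every $y\in\mathbb{R}$. Howitt–Warren martingale problem in $\mathbb{R}^n$. Put $\theta(k,l)=\int_0^1x^{k-1}(1-x)^{l-1}\nu(dx)$ for $k,l\ge1$, extended to $k,l\ge0$ by $\theta(0,0)=0$, $\theta(1,0)-\theta(0,1)=\beta$ and $\theta(k,l)=\theta(k+1,l)+\theta(k,l+1)$. For $x\in\mathbb{R}^n$ let $\pi(x)$ be the partition of $\{1,\dots,n\}$ in which $i,j$ share a block iff $x_i=x_j$. For disjoint (possibly empty) $I,J$ let $v_{I,J}\in\mathbb{R}^n$ have $i$-th entry $1$ if $i\in I$, $-1$ if $i\in J$, $0$ otherwise, and $\mathcal{V}(x)=\{v_{I,J}: I\cap J=\emptyset,\ I\cup J\in\pi(x)\}$. Weyl chambers are the images of $\{x: x_1\ge\dots\ge x_n\}$ under coordinate permutations; $D_n$ is the set of continuous $f:\mathbb{R}^n\to\mathbb{R}$ linear on each Weyl chamber; $\mathcal{A}^\theta_nf(x)=\sum_{v_{I,J}\in\mathcal{V}(x)}\theta(|I|,|J|)\nabla_{v_{I,J}}f(x)$ (one-sided directional derivatives). A continuous square-integrable semimartingale $X$ started at $x$ solves the problem if $\langle X^i,X^j\rangle(t)=\int_0^t\mathbf 1_{\{X^i(s)=X^j(s)\}}ds$ for all $i,j$ and $F(X(t))-\int_0^t\mathcal{A}^\theta_nF(X(s))ds$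 is a martingale for all $F\in D_n$. *)

(* Defs.v *)
From HB Require Import structures.
From mathcomp Require Import all_boot all_order all_algebra all_fingroup.
From mathcomp Require Import all_classical all_reals all_analysis.
From mathcomp Require Import measurable_realfun complex.

Set Implicit Arguments.
Unset Strict Implicit.
Unset Printing Implicit Defensive.

Import Order.TTheory GRing.Theory Num.Theory.
Import numFieldNormedType.Exports.

Local Open Scope classical_set_scope.
Local Open Scope ring_scope.

Section image_measure.
Context d1 d2 (T1 : measurableType d1) (T2 : measurableType d2) (R : realType).
Variables (m : {measure set T1 -> \bar R}) (f : {mfun T1 >-> T2}).

Definition image_measure : set T2 -> \bar R := pushforward m f.

Let image_measure0 : image_measure set0 = 0%E.
Proof. exact: measure0. Qed.

Let image_measure_ge0 A : (0 <= image_measure A)%E.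
Proof. exact: measure_ge0. Qed.

Let image_measure_sigma_additive : semi_sigma_additive image_measure.
Proof.
exact: (measure_semi_sigma_additive
  (s := pushforward m f : {measure set T2 -> \bar R})).
Qed.

HB.instance Definition _ := isMeasure.Build _ _ _ image_measure
  image_measure0 image_measure_ge0 image_measure_sigma_additive.

End image_measure.

Section product_of_measures.
Context (R : realType).
Local Notation Rm := (measurableTypeR R).

Definition tuple_cons n (p : n.-tuple Rm * Rm) : n.+1.-tuple Rm :=
  [the n.+1.-tuple Rm of p.2 :: p.1].

Lemma measurable_tuple_cons n : measurable_fun setT (@tuple_cons n).
Proof. by apply: measurable_cons; [exact: measurable_snd|exact: measurable_fst]. Qed.

HB.instance Definition _ n :=
  isMeasurableFun.Build _ _ _ _ (@tuple_cons n) (@measurable_tuple_cons n).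

Fixpoint tuple_measure n :
    ('I_n -> {sigma_finite_measure set Rm -> \bar R}) ->
    {measure set (n.-tuple Rm) -> \bar R} :=
  match n with
  | 0 => fun _ => dirac [tuple]
  | n'.+1 => fun m =>
      image_measure (tuple_measure (fun i => m (lift ord0 i)) \x m ord0)%E
        (@tuple_cons n')
  end.

End product_of_measures.

Definition dilation (R : realType) (c : R) :
    measurableTypeR R -> measurableTypeR R :=
  fun w => c * (w : R).

Lemma measurable_dilation (R : realType) (c : R) :
  measurable_fun setT (dilation c).
Proof. exact: (@mulrl_measurable R setT c). Qed.

HB.instance Definition _ (R : realType) (c : R) :=
  isMeasurableFun.Build _ _ _ _ (dilation c) (@measurable_dilation R c).

(* The arguments are measures; they are typed as set functions so that measures
   whose structure depends on a side condition can be passed directly. *)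
Definition weak_cvg (R : realType) (T : Type) (F : set_system T)
    (m : T -> set (measurableTypeR R) -> \bar R)
    (l : set (measurableTypeR R) -> \bar R) : Prop :=
  forall f : R -> R, continuous f -> [bounded f x | x in setT] ->
    (\int[m i]_w (f w)%:E)%E @[i --> F] --> (\int[l]_w (f w)%:E)%E.

Section processes.
Context (R : realType) d (T : measurableType d) (P : probability T R).
Implicit Types (Fil : R -> set_system T) (X Y M A C : R -> T -> R).

(* Time is [0, +oo[: values of processes and filtrations at negative times are
   never used. *)
Record filtration Fil : Prop := {
  filtration_sigma : forall t, 0 <= t -> sigma_algebra setT (Fil t) ;
  filtration_measurable : forall t, 0 <= t -> Fil t `<=` measurable ;
  filtration_mono : forall s t, 0 <= s -> s <= t -> Fil s `<=` Fil t }.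

Definition adapted Fil X : Prop :=
  forall t (B : set R), 0 <= t -> measurable B -> Fil t (X t @^-1` B).

Definition continuous_paths X : Prop :=
  forall w, {within `[0, +oo[, continuous (fun t => X t w)}.

Record martingale Fil M : Prop := {
  martingale_adapted : adapted Fil M ;
  martingale_integrable :
    forall t, 0 <= t -> P.-integrable setT (EFin \o M t) ;
  martingale_cond : forall s t E, 0 <= s -> s <= t -> Fil s E ->
    (\int[P]_(w in E) (M t w)%:E = \int[P]_(w in E) (M s w)%:E)%E }.

Definition stopping_time Fil (tau : T -> \bar R) : Prop :=
  (forall w, (0 <= tau w)%E) /\
  (forall t, 0 <= t -> Fil t [set w | (tau w <= t%:E)%E]).

Definition stopped M (tau : T -> \bar R) : R -> T -> R :=
  fun t w => M (fine (Order.min t%:E (tau w))) w.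

Definition local_martingale Fil M : Prop :=
  adapted Fil M /\
  exists tau : nat -> T -> \bar R,
    [/\ forall k, stopping_time Fil (tau k),
        forall k w, (tau k w <= tau k.+1 w)%E,
        {ae P, forall w, tau k w @[k --> \oo] --> +oo%E} &
        forall k, martingale Fil (fun t w => stopped M (tau k) t w - M 0 w)].

Record finite_variation_process Fil A : Prop := {
  fv_adapted : adapted Fil A ;
  fv_continuous : continuous_paths A ;
  fv_start : forall w, A 0 w = 0 ;
  fv_variation : forall t w, 0 <= t -> bounded_variation 0 t (fun s => A s w) }.

Record canonical_decomposition Fil X M A : Prop := {
  decomposition_martingale : local_martingale Fil M ;
  decomposition_continuous : continuous_paths M ;
  decomposition_fv : finite_variation_process Fil A ;
  decomposition_sum : forall t w, 0 <= t -> X t w = M t w + A t w }.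

Definition continuous_semimartingale Fil X : Prop :=
  exists M A, canonical_decomposition Fil X M A.

(* C = <X, Y> *)
Definition bracket Fil X Y C : Prop :=
  exists M A N B,
    [/\ canonical_decomposition Fil X M A, canonical_decomposition Fil Y N B,
        finite_variation_process Fil C &
        local_martingale Fil (fun t w => M t w * N t w - C t w)].

End processes.

Section martingale_problem.
Context (R : realType).

(* These conditions determine th. *)
Record theta_coefficients (nu : {measure set (measurableTypeR R) -> \bar R}) (beta : R)
    (th : nat -> nat -> R) : Prop := {
  theta_integral : forall k l, (0 < k)%N -> (0 < l)%N ->
    th k l = \int[nu]_(x in `[0, 1]) (x ^+ k.-1 * (1 - x) ^+ l.-1) ;
  theta_00 : th 0 0 = 0 ;
  theta_drift : th 1 0 - th 0 1 = beta ;
  theta_rec : forall k l, th k l = th k.+1 l + th k l.+1 }.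

Definition coordinate_partition n (x : 'rV[R]_n) : {set {set 'I_n}} :=
  preim_partition (fun i => x 0 i) (finset.setTfor 'I_n).

Definition block_vector n (I J : {set 'I_n}) : 'rV[R]_n :=
  \row_i ((i \in I)%:R - (i \in J)%:R).

Definition directional_derivative n (v : 'rV[R]_n) (f : 'rV[R]_n -> R)
    (x : 'rV[R]_n) : R :=
  lim (h^-1 * (f (x + h *: v) - f x) @[h --> 0^'+]).

Definition weyl_chamber n (s : 'S_n) : set 'rV[R]_n :=
  [set x | forall i j : 'I_n, (i <= j)%N -> x 0 (s j) <= x 0 (s i)].

Definition piecewise_linear n (f : 'rV[R]_n -> R) : Prop :=
  continuous f /\
  forall s : 'S_n, exists g : {scalar 'rV[R]_n},
    forall x, weyl_chamber s x -> f x = g x.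

(* The blocks are nonempty, so (I, J) |-> v_{I,J} is injective on the pairs
   below and the sum over pairs is the sum over the vectors of V(x). *)
Definition hw_generator n (th : nat -> nat -> R) (f : 'rV[R]_n -> R)
    (x : 'rV[R]_n) : R :=
  \sum_(p : {set 'I_n} * {set 'I_n} |
        [disjoint p.1 & p.2] && ((p.1 :|: p.2)%SET \in coordinate_partition x))
    th #|p.1| #|p.2| * directional_derivative (block_vector p.1 p.2) f x.

Record solves_hw_martingale_problem n (th : nat -> nat -> R)
    d (T : measurableType d) (P : probability T R) (Fil : R -> set_system T)
    (x : 'rV[R]_n) (X : R -> T -> 'rV[R]_n) : Prop := {
  hw_start : forall w, X 0 w = x ;
  hw_semimartingale :
    forall i, continuous_semimartingale P Fil (fun t w => X t w 0 i) ;
  hw_square_integrable : forall i t, 0 <= t ->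
    P.-integrable setT (fun w => (X t w 0 i ^+ 2)%:E) ;
  hw_bracket : forall i j,
    bracket P Fil (fun t w => X t w 0 i) (fun t w => X t w 0 j)
      (fun t w => \int[lebesgue_measure]_(s in `[0, t])
                    (X s w 0 i == X s w 0 j)%:R) ;
  hw_martingale : forall f, piecewise_linear f ->
    martingale P Fil (fun t w =>
      f (X t w) - \int[lebesgue_measure]_(s in `[0, t])
                    hw_generator th f (X s w)) }.

End martingale_problem.

Section flows_of_kernels.
Context (R : realType) d (T : measurableType d) (P : probability T R).
Variable K : R -> R -> T -> R -> probability (measurableTypeR R) R.

Definition kernel_event s t (x : R) (A : set R) (B : set (\bar R)) : set T :=
  [set w | B (K s t w x A)].

Definition kernel_sigma s t : set_system T :=
  <<s [set E | exists x A B,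
         [/\ measurable A, measurable B & E = kernel_event s t x A B]] >>.

(* Only the K s t with s <= t matter. The law of a random kernel is given by the
   joint laws of the variables K s t x A for finitely many x and A, and these
   are determined on the rectangles of flow_stationary. *)
Record stochastic_flow : Prop := {
  flow_measurable : forall s t (A : set R), s <= t -> measurable A ->
    measurable_fun setT (fun p : T * measurableTypeR R => K s t p.1 p.2 A) ;
  flow_id : forall s x,
    {ae P, forall w, forall A : set R, measurable A -> K s s w x A = \d_x A} ;
  flow_comp : forall s t u x, s <= t -> t <= u ->
    {ae P, forall w, forall A : set R, measurable A ->
       (\int[K s t w x]_y K t u w y A = K s u w x A)%E} ;
  flow_independent : forall n (t : nat -> R) (E : 'I_n -> set T),
    (forall i, (i < n)%N -> t i < t i.+1) ->
    (forall i : 'I_n, kernel_sigma (t i) (t i.+1) (E i)) ->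
    P (\bigcap_i E i) = (\prod_(i < n) P (E i))%E ;
  flow_stationary : forall s t h m (x : 'I_m -> R) (A : 'I_m -> set R)
      (B : 'I_m -> set (\bar R)), s <= t ->
    (forall i, measurable (A i)) -> (forall i, measurable (B i)) ->
    P (\bigcap_i kernel_event s t (x i) (A i) (B i)) =
    P (\bigcap_i kernel_event (s + h) (t + h) (x i) (A i) (B i)) }.

Definition npoint_transition n s t (x : 'rV[R]_n) (E : set (n.-tuple (measurableTypeR R))) :
    \bar R :=
  (\int[P]_w tuple_measure (fun i : 'I_n => K s t w (x 0%R i)) E)%E.

Definition tuple_of_row n (x : 'rV[R]_n) : n.-tuple (measurableTypeR R) := [tuple x 0 i | i < n].

Definition npoint_motion n d' (T' : measurableType d') (P' : probability T' R)
    (Fil : R -> set_system T') (X : R -> T' -> 'rV[R]_n) : Prop :=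
  (forall i, adapted Fil (fun t w => X t w 0 i)) /\
  forall s t B (E : set (n.-tuple (measurableTypeR R))),
    0 <= s -> s <= t -> Fil s B -> measurable E ->
    P' (B `&` [set w | E (tuple_of_row (X t w))]) =
    (\int[P']_(w in B) npoint_transition s t (X s w) E)%E.

(* The transition probabilities determine the law of the n-point motion started
   at x; hw_npoint asks that a version of it solve the martingale problem. *)
Record howitt_warren_flow (nu : {measure set (measurableTypeR R) -> \bar R}) (beta : R) : Prop := {
  hw_flow : stochastic_flow ;
  hw_npoint : exists2 th, theta_coefficients nu beta th &
    forall n (x : 'rV[R]_n), (0 < n)%N ->
    exists d' (T' : measurableType d') (P' : probability T' R)
        (Fil : R -> set_system T') (X : R -> T' -> 'rV[R]_n),
      [/\ filtration Fil, npoint_motion P' Fil X &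
          solves_hw_martingale_problem th P' Fil x X] }.

Definition hw_process (t : R) (w : T)  : probability (measurableTypeR R) R := K 0 t w 0.

End flows_of_kernels.

Section atoms.
Context (R : realType) d (T : measurableType d) (P : probability T R).
Local Notation Rm := (measurableTypeR R).

Definition atoms (rho : probability Rm R) : set (R * R) :=
  [set a | (0 < rho [set a.1])%E /\ a.2 = fine (rho [set a.1])].

Definition atom_intensity (rho : T -> probability Rm R) (A1 A2 : set R) : \bar R :=
  (\int[P]_om \esum_(a in atoms (rho om)) (\1_(A1 `*` A2) a)%:E)%E.

Record disintegrates (gamma : set R -> set R -> \bar R) (g : R.-ker Rm ~> Rm) :
    Prop := {
  disintegrates_pos : forall y, g y `]-oo, 0]%classic = 0%E ;
  disintegratesE : forall A1 A2 : set R, measurable A1 -> measurable A2 ->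
    A2 `<=` `]0, +oo[ ->
    gamma A1 A2 = (\int[lebesgue_measure]_(y in A1) g y A2)%E }.

(* m y is the finite measure w g(y,dw) on [0, +oo[ for almost every y, so both
   are versions of the disintegration of w gamma(dy,dw). Keeping m apart from g
   does not force the version at an exceptional y to give no mass to 0. *)
Record weighted_version (g : R.-ker Rm ~> Rm) (m : R.-ftker Rm ~> Rm) : Prop := {
  weighted_nneg : forall y, m y `]-oo, 0[%classic = 0%E ;
  weightedE : {ae lebesgue_measure, forall y : R, forall A : set R,
    measurable A -> m y A = (\int[g y]_(w in A) (w : R)%:E)%E} }.

End atoms.

Section moment_formula.
Context (R : realType).
Local Notation Rm := (measurableTypeR R).

Definition expi (r : R) : R[i] := Complex (cos r) (sin r).

Definition complex_integral d (T : measurableType d)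
    (mu : {measure set T -> \bar R}) (f : T -> R[i]) : R[i] :=
  Complex (\int[mu]_x complex.Re (f x)) (\int[mu]_x complex.Im (f x)).

Definition u_factor (theta p q : R) : R[i] :=
  ('i%C * (theta * (p - q))%:C%C + (q * p)%:C%C) /
  ('i%C * (theta * (p - q))%:C%C - (q * p)%:C%C).

Definition u_integrand n (theta t : R) (x y : 'rV[R]_n) (k : 'I_n -> R) : R[i] :=
  (expR (- (t * \sum_(i < n) k i ^+ 2 / 2)))%:C%C *
  \sum_(s : 'S_n)
    expi (\sum_(i < n) k (s i) * (x 0 i - y 0 (s i))) *
    \prod_(a < n) \prod_(b < n | (a < b)%N && (s b < s a)%N)
      u_factor theta (k (s a)) (k (s b)).

Definition u_moment n (theta t : R) (x y : 'rV[R]_n) : R[i] :=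
  (((2 * pi) ^+ n)^-1)%:C%C *
  complex_integral (tuple_measure (fun _ : 'I_n => lebesgue_measure))
    (fun k => u_integrand theta t x y (tnth k)).

(* m(y,dw) = w g(y,dw), so that int w^n g(y,dw) = int w^(n-1) m(y,dw) *)
Definition moment_identities (theta t : R) (m : R.-ftker Rm ~> Rm) : Prop :=
  forall n (y : R), (0 < n)%N ->
  exists2 r : R, (\int[m y]_w ((w : R) ^+ n.-1)%:E = r%:E)%E &
    r%:C%C = n%:R^-1 * (theta%:C%C)^-1 ^+ n.-1 *
             u_moment theta t (0 : 'rV[R]_n) (const_mx y).

End moment_formula.

Definition characteristic_measure (R : realType) (theta : {posnum R}) :
    {measure set (measurableTypeR R) -> \bar R} :=
  mscale (theta%:num / 2)%:nng (mrestr lebesgue_measure (measurable_itv `[0, 1])).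

Definition rescaled_measure (R : realType)
    (m : R -> R.-ftker (measurableTypeR R) ~> (measurableTypeR R)) (t x : R) :
    {measure set (measurableTypeR R) -> \bar R} :=
  image_measure
    (mscale (Num.sqrt (2 * pi * t) * expR (x ^+ 2 / 2))%:nng
       (m t (Num.sqrt t * x)))
    (dilation (Num.sqrt t)).

(* Main.v *)
(** In the variable k / sqrt t the integrand of u_t^(n)(0, (sqrt t x, ..., sqrt t x))
    becomes the integrand at time 1 with theta replaced by theta sqrt t. As the
    latter grows, every factor of the product over inversions has modulus at most 1
    and tends to 1 off the diagonals, so that dominated convergence leaves n! times
    the n-th power of the Fourier transform of a Gaussian. Hence every moment of
    mu_{t,x} converges to the corresponding moment k!/l^k of the exponential law.

    These moments determine the limit: the expansion of exp(-c w) with c = l/4 may be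
    truncated inside w^k exp(-j c w), because the remainder is controlled by the
    moments alone. This gives the convergence of the integrals of all polynomials in
    exp(-c w), then, by Bernstein approximation, of all continuous functions that
    vanish for large w, and a cutoff (first moment) reaches the bounded continuous
    functions. *)

From HB Require Import structures.
Require Import Defs.
From mathcomp Require Import all_boot all_order all_algebra all_fingroup.
From mathcomp Require Import all_classical all_reals all_analysis.
From mathcomp Require Import measurable_realfun complex ring lra.

Import Order.TTheory GRing.Theory Num.Theory.
Import numFieldNormedType.Exports.

Local Open Scope classical_set_scope.
Local Open Scope ring_scope.

Set Implicit Arguments.
Unset Strict Implicit.
Unset Printing Implicit Defensive.

(** * Bernstein approximation *)

(** Polynomials are unbounded on [[0, +oo[], so the approximation is made in [y = exp (- c w)],
    which maps that half-line into []0, 1]]. Expanding [exp (- c w)] trades it for moments, and the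
    factorials of the exponential law allow this only for small [c]: bounding a binomial coefficient
    by a power of 2 leaves the geometric ratio [2 c / l], which is [1 / 2] for [c = l / 4]. No bound
    uniform in the time and in the order of the moments is used: each truncation involves finitely
    many moments, and only the limit integral of its error has to be small.

    The rate arises as follows. In the formula of index [n] the [n!] permutations against the factor
    [1 / n] leave [(n - 1)!], the right factorial because the measure already carries one weight
    [w]. The Fourier transform and the prefactor contribute [n] factors
    [1 / (sqrt (2 pi) exp (x^2 / 2))], one of which the normalization cancels; the other [n - 1],
    with [theta^(1 - n)], form the power of the rate. *)

Section bernstein.
Context {R : realType}.
Implicit Types (phi : nat -> R) (h : R -> R).

(* The expectation of [phi] at the number of successes in [n] independent trials
   of success probability [y], by conditioning on the first trial: this recursion
   avoids binomial coefficients. *)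
Fixpoint bernstein (n : nat) phi (y : R) : R :=
  if n is n'.+1 then
    (1 - y) * bernstein n' phi y + y * bernstein n' (phi \o succn) y
  else phi 0%N.

(** The weights [1 - y] and [y] are nonnegative with sum 1, so the recursion averages pointwise
    bounds. Only the nodes [i <= n] are read, which later keeps [i / n] in the unit interval. *)
Lemma dist_bernstein n phi psi a y : 0 <= y <= 1 ->
  (forall i, (i <= n)%N -> `|phi i - a| <= psi i) ->
  `|bernstein n phi y - a| <= bernstein n psi y.
Proof.
move=> /andP[y0 y1].
elim: n phi psi => [|n IHn] phi psi phi_a /=; first exact: phi_a.
have -> : (1 - y) * bernstein n phi y + y * bernstein n (phi \o succn) y - a =
  (1 - y) * (bernstein n phi y - a) + y * (bernstein n (phi \o succn) y - a).
  by ring.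
rewrite (le_trans (ler_normD _ _))// !normrM.
rewrite (ger0_norm y0) ger0_norm ?subr_ge0//.
apply: lerD; apply: ler_wpM2l; rewrite ?subr_ge0// IHn// => i le_in.
  by apply: phi_a; exact: leqW.
exact: phi_a.
Qed.

Lemma bernsteinD n phi psi y :
  bernstein n (fun i => phi i + psi i) y =
  bernstein n phi y + bernstein n psi y.
Proof. by elim: n phi psi => [//|n IHn] phi psi /=; rewrite !IHn; ring. Qed.

Lemma bernsteinZ n a phi y :
  bernstein n (fun i => a * phi i) y = a * bernstein n phi y.
Proof. by elim: n phi => [//|n IHn] phi /=; rewrite !IHn; ring. Qed.

Lemma bernstein_cst n a y : bernstein n (fun=> a) y = a.
Proof. by elim: n => [//|n IHn] /=; rewrite -/(bernstein n _ y) IHn; ring. Qed.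

(** Binomial variance plus squared bias. The centre [a] is arbitrary because shifting by [succn]
    replaces [a] by [a - 1] in the induction. *)
Lemma bernstein_sqr n a y :
  bernstein n (fun i => (i%:R - a) ^+ 2) y =
  n%:R * y * (1 - y) + (n%:R * y - a) ^+ 2.
Proof.
elim: n a => [|n IHn] a /=; first by ring.
rewrite IHn (_ : _ \o _ = fun i => (i%:R - (a - 1)) ^+ 2); last first.
  by apply/funext => i /=; rewrite -natr1; ring.
by rewrite IHn -natr1; ring.
Qed.

(** Uniform continuity settles close points; at distance at least [r], the trivial bound [2 * B] is
    at most [2 * B / r ^+ 2 * (x - y) ^+ 2]. A quadratic bound is what [bernstein_sqr] can average,
    as in Chebyshev's inequality. *)
Lemma continuous_quadratic_modulus h (B e : R) : continuous h ->
  (forall x, `|h x| <= B) -> 0 < e ->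
  exists2 C, 0 <= C & forall x y, 0 <= x <= 1 -> 0 <= y <= 1 ->
    `|h x - h y| <= e + C * (x - y) ^+ 2.
Proof.
move=> ch hB e0.
have B0 : 0 <= B by exact: le_trans (hB 0).
pose P (d x : R) := forall y : R, `|x - y| < d -> `|h x - h y| <= e.
(* [P d x] says that the radius [d] works at [x] for the tolerance [e]. The near-covering form of
   compactness makes one [d] work on the whole interval. *)
have /compact_near_coveringP/(_ _ (0:R)^'+ P) : compact `[0:R, 1]%classic.
  exact: segment_compact.
move=> /(_ _)[].
  move=> x _; have /cvgrPdist_lt/(_ (e / 2))/(_ (divr_gt0 e0 (ltr0Sn _ 1)))
    [d /= d0 hd] := ch x.
  exists (ball x (d / 2), [set i : R | i < d / 2]) => /=.
    split; first by apply: nbhsx_ballx; rewrite divr_gt0.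
    by apply: nbhs_right_lt; rewrite divr_gt0.
  move=> [x' i] /= [xx' id2] y x'y.
  have hx' : `|h x - h x'| < e / 2.
    by apply: hd; apply: lt_trans xx' _; rewrite ltr_pdivrMr// ltr_pMr// ltr1n.
  have hy : `|h x - h y| < e / 2.
    apply: hd => /=; rewrite -(subrKA x').
    rewrite (le_lt_trans (ler_normD _ _))// [ltRHS]splitr ltrD//.
    exact: lt_trans id2.
  rewrite ltW// -(subrKA (h x)) (le_lt_trans (ler_normD _ _))//.
  by rewrite [ltRHS]splitr ltrD// distrC.
move=> d /= d0 hd.
pose r := d / 2.
have r0 : 0 < r by rewrite divr_gt0.
have {}hd : `[0, 1] `<=` P r.
  apply: hd => //=; rewrite /r sub0r normrN gtr0_norm ?divr_gt0//.
  by rewrite ltr_pdivrMr// ltr_pMr// ltr1n.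
exists (2 * B / r ^+ 2); first by rewrite divr_ge0 ?sqr_ge0// mulr_ge0.
move=> x y x01 y01; have [xyr|rxy] := ltP `|x - y| r.
  rewrite (le_trans (hd x _ y xyr))//= ?in_itv//= lerDl mulr_ge0 ?sqr_ge0//.
  by rewrite divr_ge0 ?sqr_ge0// mulr_ge0.
rewrite (le_trans (ler_normB _ _))// (le_trans (lerD (hB _) (hB _)))//.
rewrite (@le_trans _ _ (2 * B / r ^+ 2 * (x - y) ^+ 2))//; last first.
  by rewrite lerDr ltW.
have rxy2 : r ^+ 2 <= (x - y) ^+ 2.
  by rewrite -[leRHS]real_normK ?num_real// lerXn2r// ?nnegrE ltW.
by rewrite mulrAC ler_pdivlMr ?exprn_gt0//; nra.
Qed.

Lemma bernstein_approx h (B e : R) : continuous h ->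
  (forall x, `|h x| <= B) -> 0 < e ->
  exists n, forall y, 0 <= y <= 1 ->
    `|h y - bernstein n (fun i => h (i%:R / n%:R)) y| <= e.
Proof.
move=> ch hB e0; have e20 : 0 < e / 2 by rewrite divr_gt0.
have [C C0 hC] := continuous_quadratic_modulus ch hB e20.
(* [n] exceeds [C / (e / 2)], so that the averaged quadratic term, at most [C / n], stays below
   [e / 2]. *)
pose n := (Num.truncn (C / (e / 2))).+1.
have n0 : 0 < n%:R :> R by rewrite ltr0n.
exists n => y y01; have /andP[y0 y1] := y01.
have Hmod i : (i <= n)%N ->
    `|h (i%:R / n%:R) - h y| <= e / 2 + C / n%:R ^+ 2 * (i%:R - n%:R * y) ^+ 2.
  move=> le_in; have -> : C / n%:R ^+ 2 * (i%:R - n%:R * y) ^+ 2 =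
      C * (i%:R / n%:R - y) ^+ 2.
    by field; rewrite gt_eqF.
  apply: hC => //; rewrite divr_ge0// ler_pdivrMr// mul1r ler_nat//.
rewrite distrC (le_trans (dist_bernstein y01 Hmod))//.
rewrite bernsteinD bernstein_cst bernsteinZ bernstein_sqr subrr expr0n addr0.
rewrite [leRHS]splitr lerD2l.
have -> : C / n%:R ^+ 2 * (n%:R * y * (1 - y)) = C / n%:R * (y * (1 - y)).
  by field; rewrite gt_eqF.
rewrite (@le_trans _ _ (C / n%:R))//.
  by rewrite ler_piMr// ?divr_ge0//; nra.
rewrite ler_pdivrMr// mulrC -ler_pdivrMr// ltW//.
by rewrite truncnS_gt.
Qed.
End bernstein.

(** * Taylor expansion of exp(- z) with control of the remainder *)

Section expR_remainder.
Context {R : realType}.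

Lemma ge0_derive_le (f df : R -> R) (z : R) :
  (forall x : R, is_derive x 1 f (df x)) -> (forall x, 0 <= x -> 0 <= df x) ->
  0 <= z -> f 0 <= f z.
Proof.
move=> fdf df0 z0; have [|c] := MVT_segment z0 (fun x _ => fdf x).
  by apply: derivable_within_continuous => x _; exact: ex_derive.
rewrite in_itv/= => /andP[c0 _]; rewrite subr0 => fz.
by rewrite -subr_ge0 fz mulr_ge0// df0.
Qed.

Lemma is_derive_expn_factB n (f : R -> R) (df z : R) : is_derive z 1 f df ->
  is_derive z 1 (fun z : R => z ^+ n.+1 / n.+1`!%:R - f z) (z ^+ n / n`!%:R - df).
Proof.
move=> fdf.
have dX := is_deriveX n.+1 (is_derive_id z (1 : R)).
have := is_deriveB (is_deriveZ (n.+1`!%:R^-1) dX) fdf.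
rewrite (_ : _ \*: _ - f = fun z : R => z ^+ n.+1 / n.+1`!%:R - f z); last first.
  by apply/funext => x; rewrite !fctE /= mulrC.
move/is_derive_eq; apply.
rewrite /GRing.scale/= mulr1 -mulr_natr factS natrM.
by field; rewrite nat1r !pnatr_eq0 -lt0n fact_gt0.
Qed.

(* The sign-adjusted Taylor remainder of exp(- z): the derivative of each one is
   the previous one, which gives its sign and its size by induction. *)
Fixpoint expRN_remainder n (z : R) : R :=
  if n is n'.+1 then z ^+ n' / n'`!%:R - expRN_remainder n' z else expR (- z).

Lemma expRN_taylor n (z : R) :
  expR (- z) = \sum_(i < n) (- z) ^+ i / i`!%:R + (-1) ^+ n * expRN_remainder n z.
Proof.
elim: n => [|n IHn]; first by rewrite big_ord0 add0r mul1r.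
rewrite IHn big_ord_recr/= exprS (exprNn z); ring.
Qed.

Lemma is_derive_expRN_remainder n (z : R) :
  is_derive z 1 (expRN_remainder n.+1) (expRN_remainder n z).
Proof.
have dexp : is_derive z 1 (fun z => expR (- z)) (- expR (- z)).
  by apply: is_derive_eq; rewrite mulrN1.
elim: n => [|n IHn].
  rewrite (_ : expRN_remainder 1 = cst 1 - (fun z => expR (- z))); last first.
    by apply/funext => x /=; rewrite fctE expr0 fact0 invr1 mulr1.
  by apply: is_derive_eq; rewrite sub0r opprK.
exact: (is_derive_expn_factB n IHn).
Qed.

Lemma expRN_remainder_bound n (z : R) : 0 <= z ->
  0 <= expRN_remainder n z <= z ^+ n / n`!%:R.
Proof.
move=> z0; elim: n z z0 => [|n IHn] z z0.
  by rewrite /= expR_ge0 expr0 fact0 invr1 mulr1 -expR0 ler_expR oppr_le0.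
have r0 : expRN_remainder n.+1 0 = 0.
  elim: n {IHn} => [|n IHn].
    by rewrite /= expr0 fact0 invr1 oppr0 expR0 mulr1 subrr.
  have -> : expRN_remainder n.+2 0 =
    0 ^+ n.+1 / n.+1`!%:R - expRN_remainder n.+1 0 by [].
  by rewrite IHn expr0n mul0r subr0.
apply/andP; split.
  rewrite -{1}r0; apply: ge0_derive_le z0 => [x|x x0].
    exact: is_derive_expRN_remainder.
  by have /andP[] := IHn x x0.
(* The upper bound is the positivity of the next remainder, whose derivative is nonnegative by the
   upper bound one order lower. *)
have := @ge0_derive_le (fun x => x ^+ n.+1 / n.+1`!%:R - expRN_remainder n.+1 x)
  (fun x => x ^+ n / n`!%:R - expRN_remainder n x) z.
rewrite r0 expr0n mul0r subr0 subr_ge0; apply => //.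
  by move=> x; apply: is_derive_expn_factB; exact: is_derive_expRN_remainder.
by move=> x x0; rewrite subr_ge0; have /andP[] := IHn x x0.
Qed.

Lemma expRN_taylor_bound n (z : R) : 0 <= z ->
  `|expR (- z) - \sum_(i < n) (- z) ^+ i / i`!%:R| <= z ^+ n / n`!%:R.
Proof.
move=> z0; have /andP[r0 rn] := expRN_remainder_bound n z0.
by rewrite (expRN_taylor n) addrC addKr normrM normrX normrN1 expr1n mul1r ger0_norm.
Qed.

End expR_remainder.

(** * Convergence of integrals, and the method of moments *)

Section integral_convergence.
Context {R : realType} {d : measure_display} {T : measurableType d} {I : Type}.
Variables (F : set_system I) (FF : Filter F).
Variables (m : I -> {measure set T -> \bar R}) (mu : {measure set T -> \bar R}).
Variables (D : set T) (mD : measurable D).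
Implicit Types f g h : T -> R.

(** Integrability is carried along because linearity of the real-valued integral relies on it; for
    the measures [m i] it is only asked eventually along [F]. *)
Record integral_cvg f : Prop := {
  integral_cvg_lim : mu.-integrable D (EFin \o f) ;
  integral_cvg_near : \forall i \near F, (m i).-integrable D (EFin \o f) ;
  integral_cvg_cvg :
    \int[m i]_(w in D) f w @[i --> F] --> \int[mu]_(w in D) f w }.

Lemma integral_cvg_ext f g : f =1 g -> integral_cvg f -> integral_cvg g.
Proof. by move=> /funext ->. Qed.

Lemma integral_cvgD f g : integral_cvg f -> integral_cvg g ->
  integral_cvg (fun w => f w + g w).
Proof.
move=> [f1 f2 f3] [g1 g2 g3]; split.
- exact: (integrableD mD f1 g1).
- by near=> i; apply: (@integrableD _ _ _ _ D mD (EFin \o f) (EFin \o g)); near: i.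
- rewrite RintegralD//; apply: (cvg_trans _ (cvgD f3 g3)).
  apply: near_eq_cvg; near=> i; rewrite RintegralD//; near: i => //.
Unshelve. all: end_near. Qed.

Lemma integral_cvgZ (a : R) f : integral_cvg f -> integral_cvg (fun w => a * f w).
Proof.
move=> [f1 f2 f3]; split.
- exact: (integrableZl mD a f1).
- by near=> i; apply: (@integrableZl _ _ _ _ D mD a (EFin \o f)); near: i.
- rewrite RintegralZl//; apply: (cvg_trans _ (cvgMl_tmp (a := a) f3)).
  by apply: near_eq_cvg; near=> i; rewrite RintegralZl//; near: i.
Unshelve. all: end_near. Qed.

Lemma integral_cvg_sum n (f : 'I_n -> T -> R) : (0 < n)%N ->
  (forall i, integral_cvg (f i)) ->
  integral_cvg (fun w => \sum_(i < n) f i w).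
Proof.
case: n f => // n f _; elim: n f => [|n IHn] f fcvg.
  by apply: integral_cvg_ext (fcvg ord0) => w; rewrite big_ord1.
apply: (integral_cvg_ext (f :=
  fun w => (\sum_(i < n.+1) f (widen_ord (leqnSn _) i) w) + f ord_max w)).
  by move=> w; rewrite [RHS]big_ord_recr.
by apply: integral_cvgD => //; exact: IHn.
Qed.

(** Smallness of the majorant [h] is required under the limit measure alone: since the integrals of
    [h] converge too, they are eventually small under [m i]. No estimate uniform in [i] has to be
    supplied. *)
Lemma integral_cvg_squeeze f : measurable_fun D f ->
  (forall e, 0 < e -> exists g h, [/\ integral_cvg g, integral_cvg h,
    forall w, D w -> `|f w - g w| <= h w & \int[mu]_(w in D) h w <= e]) ->
  integral_cvg f.
Proof.
move=> mf Hf.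
have intf (nu : {measure set T -> \bar R}) g h :
    nu.-integrable D (EFin \o g) -> nu.-integrable D (EFin \o h) ->
    (forall w, D w -> `|f w - g w| <= h w) -> nu.-integrable D (EFin \o f).
  move=> ig ih fgh.
  apply: (@le_integrable _ _ _ nu D mD _
      (fun w => (`|g w| + h w)%:E)).
  - exact/measurable_EFinP.
  - move=> w Dw /=; rewrite lee_fin.
    rewrite [leRHS]ger0_norm; last first.
      by rewrite addr_ge0// (le_trans _ (fgh w Dw)).
    by rewrite -[f w](subrK (g w)) (le_trans (ler_normD _ _))// addrC lerD2l fgh.
  - exact: (integrableD mD (integrable_norm ig) ih).
have distf (nu : {measure set T -> \bar R}) g h :
    nu.-integrable D (EFin \o g) -> nu.-integrable D (EFin \o h) ->
    (forall w, D w -> `|f w - g w| <= h w) ->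
    `|\int[nu]_(w in D) f w - \int[nu]_(w in D) g w| <= \int[nu]_(w in D) h w.
  move=> ig ih fgh; have if_ := intf _ _ _ ig ih fgh.
  have ifg : nu.-integrable D (EFin \o (fun w => f w - g w)).
    by apply: (integrableB mD if_ ig).
  rewrite -RintegralB// (le_trans (le_normr_Rintegral mD ifg))//.
  by apply: le_Rintegral => //; exact: integrable_norm.
have [g [h [[g1 g2 _] [h1 h2 _] fgh _]]] := Hf 1 ltr01.
split; first exact: intf fgh.
  by near=> i; apply: (intf _ _ _ _ _ fgh); near: i.
apply/cvgrPdist_le => e e0.
(* Four quarters: one for [f - g] under [mu], one for the convergence of the integrals of [g], and
   two for [f - g] under [m i], where the integral of [h] is within [e / 4] of a limit that is at
   most [e / 4]. *)
have e4 : 0 < e / 4 by rewrite divr_gt0.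
have [{g1 g2}g [{h1 h2 fgh}h [[g1 g2 g3] [h1 h2 h3] fgh he]]] := Hf _ e4.
move/cvgrPdist_le/(_ _ e4) : g3 => g3; move/cvgrPdist_le/(_ _ e4) : h3 => h3.
near=> i.
have gi : `|\int[mu]_(w in D) g w - \int[m i]_(w in D) g w| <= e / 4.
  by near: i.
have hi : `|\int[mu]_(w in D) h w - \int[m i]_(w in D) h w| <= e / 4.
  by near: i.
have fmu := distf _ _ _ g1 h1 fgh.
have fm : `|\int[m i]_(w in D) f w - \int[m i]_(w in D) g w| <=
    \int[m i]_(w in D) h w.
  by apply: distf => //; near: i.
move: gi hi fmu fm; rewrite !ler_norml => /andP[? ?] /andP[? ?] /andP[? ?] /andP[? ?].
by apply/andP; split; lra.
Unshelve. all: end_near. Qed.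

End integral_convergence.

Section exponential_moments_method.
Context {R : realType} {I : Type}.
Local Notation Rm := (measurableTypeR R).
Variables (F : set_system I) (FF : Filter F).
Variables (m : I -> {measure set Rm -> \bar R}) (mu : {measure set Rm -> \bar R}).
Variables (l : R) (l0 : 0 < l).
Local Notation D := (`[0%R, +oo[%classic : set Rm).
Local Notation integral_cvg := (@integral_cvg R _ Rm I F m mu D).
Hypothesis moment_cvg : forall k, integral_cvg (fun w : R => w ^+ k).
Hypothesis momentE : forall k, \int[mu]_(w in D) ((w : R) ^+ k) = k`!%:R / l ^+ k.

Let mD : measurable D.
Proof. exact: measurable_itv. Qed.

Variables (c : R) (cE : c = l / 4).

(** Induction on [j] for all [k] at once: replacing one factor [exp (- c w)] by a Taylor polynomial
    lowers [j] and raises [k]. The other exponential factors are at most 1, so the error is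
    dominated by a multiple of a single power of [w]. *)
Lemma integral_cvg_monomial_expR k j :
  integral_cvg (fun w : R => w ^+ k * expR (- (c * w)) ^+ j).
Proof.
have c0 : 0 < c by rewrite cE divr_gt0.
elim: j k => [|j IHj] k.
  by apply: integral_cvg_ext (moment_cvg k) => w; rewrite mulr1.
apply: integral_cvg_squeeze => //.
  apply: measurable_funTS; apply: measurable_funM; first exact: exprn_measurable.
  apply: measurable_funX; apply: measurableT_comp => //.
  by apply: measurableT_comp => //; exact: mulrl_measurable.
move=> e e0.
have [J HJ] : exists J : nat, 2 ^+ k * k`!%:R / l ^+ k * (1 / 2) ^+ J.+1 <= e.
  have : (2 ^+ k * k`!%:R / l ^+ k : R) * (1 / 2) ^+ n @[n --> \oo] --> (0:R).
    rewrite -[X in _ --> X](mulr0 (2 ^+ k * k`!%:R / l ^+ k)).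
    apply: cvgMl_tmp; apply: cvg_expr.
    by rewrite ger0_norm; lra.
  move=> /cvgrPdist_le/(_ e e0)[N _ HN]; exists N.
  have := HN N.+1 (leqnSn N).
  rewrite /= sub0r normrN; apply: le_trans; exact: ler_norm.
exists (fun w => \sum_(i < J.+1) (- c) ^+ i / i`!%:R *
   (w ^+ (k + i) * expR (- (c * w)) ^+ j)).
exists (fun w => c ^+ J.+1 / J.+1`!%:R * w ^+ (k + J.+1)); split.
- by apply: integral_cvg_sum => // i; exact: integral_cvgZ.
- exact: integral_cvgZ.
- move=> w; rewrite /= in_itv/= andbT => w0.
  have -> : \sum_(i < J.+1) (- c) ^+ i / i`!%:R *
      (w ^+ (k + i) * expR (- (c * w)) ^+ j) =
      w ^+ k * expR (- (c * w)) ^+ j *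
      \sum_(i < J.+1) (- (c * w)) ^+ i / i`!%:R.
    rewrite mulr_sumr; apply: eq_bigr => i _.
    have -> : (- (c * w)) ^+ i = (- c) ^+ i * w ^+ i by rewrite -mulNr exprMn.
    by rewrite exprD; move: ((- c) ^+ i) (expR _ ^+ j) => a b; ring.
  rewrite exprSr mulrA -mulrBr normrM.
  rewrite ger0_norm ?mulr_ge0 ?exprn_ge0 ?expR_ge0//.
  have cw0 : 0 <= c * w by rewrite mulr_ge0// ltW.
  have -> : c ^+ J.+1 / J.+1`!%:R * w ^+ (k + J.+1) =
    w ^+ k * 1 * ((c * w) ^+ J.+1 / J.+1`!%:R).
    by rewrite exprMn exprD; ring.
  apply: ler_pM => //; rewrite ?mulr_ge0 ?exprn_ge0 ?expR_ge0//.
    apply: ler_wpM2l; rewrite ?exprn_ge0//.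
    by rewrite exprn_ile1 ?expR_ge0// -expR0 ler_expR oppr_le0.
  exact: expRN_taylor_bound.
- rewrite RintegralZl//; last by case: (moment_cvg (k + J.+1)).
  rewrite momentE (le_trans _ HJ)//.
  (* The limit integral of the error is ['C(k + J.+1, k)] times [k! / l ^ k / 4 ^ J.+1]. The
     coefficient is one term of a row of Pascal's triangle with sum [2 ^ (k + J.+1)], which yields
     the bound made small in [HJ]. *)
  have -> : (k + J.+1)`!%:R = 'C(k + J.+1, k)%:R * k`!%:R * J.+1`!%:R :> R.
    by rewrite -!natrM -mulnA -(bin_fact (leq_addr J.+1 k)) addKn.
  have -> : c ^+ J.+1 / (J.+1)`!%:R *
    ('C(k + J.+1, k)%:R * k`!%:R * (J.+1)`!%:R / l ^+ (k + J.+1)) =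
    'C(k + J.+1, k)%:R * (k`!%:R / l ^+ k / 4 ^+ J.+1).
    rewrite cE expr_div_n exprD.
    by field; rewrite ?expf_neq0 ?gt_eqF// ?ltr0n ?fact_gt0 ?exprn_gt0.
  have -> : 2 ^+ k * k`!%:R / l ^+ k * (1 / 2) ^+ J.+1 =
    2 ^+ (k + J.+1) * (k`!%:R / l ^+ k / 4 ^+ J.+1) :> R.
    rewrite (_ : 4 = 2 * 2 :> R); last by rewrite -natrM.
    rewrite expr_div_n expr1n exprMn exprD.
    by field; rewrite ?expf_neq0 ?gt_eqF// ?ltr0n ?fact_gt0 ?exprn_gt0.
  apply: ler_wpM2r.
    by rewrite !divr_ge0// ?exprn_ge0// ltW.
  rewrite -natrX ler_nat.
  have -> : (2 ^ (k + J.+1) = \sum_(i < (k + J.+1).+1) 'C(k + J.+1, i))%N.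
    by rewrite (expnDn 1 1); apply: eq_bigr => i _; rewrite !exp1n !muln1.
  have kJ : (k < (k + J.+1).+1)%N by rewrite ltnS leq_addr.
  by rewrite (bigD1 (Ordinal kJ))//= leq_addr.
Qed.

Lemma integral_cvg_bernstein n (phi : nat -> R) :
  integral_cvg (fun w : R => bernstein n phi (expR (- (c * w)))).
Proof.
(* The recursion of [bernstein] multiplies by [y], here [exp (- c w)], so the induction needs a
   spare power of it. *)
suff H j : integral_cvg (fun w : R => expR (- (c * w)) ^+ j *
    bernstein n phi (expR (- (c * w)))).
  by apply: integral_cvg_ext (H 0%N) => w; rewrite mul1r.
elim: n phi j => [|n IHn] phi j.
  apply: integral_cvg_ext (integral_cvgZ FF mD (phi 0%N)
    (integral_cvg_monomial_expR 0 j)) => w.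
  by rewrite /= mul1r mulrC.
apply: integral_cvg_ext (integral_cvgD FF mD (integral_cvgD FF mD (IHn phi j)
  (integral_cvgZ FF mD (-1) (IHn phi j.+1))) (IHn (phi \o succn) j.+1)) => w.
by rewrite /= exprS; ring.
Qed.

Lemma integral_cvg_cst (a : R) : integral_cvg (fun=> a).
Proof.
by apply: integral_cvg_ext (integral_cvgZ FF mD a (moment_cvg 0)) => w; rewrite mulr1.
Qed.

Lemma integral_cvg_vanishing (g : R -> R) (B N : R) : continuous g ->
  (forall w, `|g w| <= B) -> (forall w, N <= w -> g w = 0) -> integral_cvg g.
Proof.
move=> cg gB gN.
have c0 : 0 < c by rewrite cE divr_gt0.
(* [g] read in the variable [y = exp (- c w)]. Bounding [y] below by [exp (- c N)] removes the
   singularity of [ln] at 0 and makes [h] continuous on the whole line; it changes nothing on []0,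
   1]], because [g] vanishes from [N] on. *)
pose h y := g (- ln (Num.max y (expR (- (c * N)))) / c).
have ch : continuous h.
  pose a := expR (- (c * N)).
  have cmax : continuous (fun y : R => Num.max y a : R).
    by move=> y; apply: (@continuous_max R R id (cst a)); [exact: cvg_id|exact: cvg_cst].
  move=> y; apply: (@continuous_comp R R R (fun y => Num.max y a)
    (fun y => g (- ln y / c)) y (cmax y)).
  apply: (@continuous_comp R R R (fun y => - ln y / c) g); last exact: cg.
  apply: (@cvgM R); last exact: cvg_cst.
  apply: (@cvgN R R); apply: continuous_ln.
  by rewrite lt_max expR_gt0 orbT.
have hE w : h (expR (- (c * w))) = g w.
  rewrite /h; have [wN|Nw] := leP w N.
    rewrite max_l ?ler_expR ?lerN2 ?ler_pM2l// expRK opprK mulrC mulKf//.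
    by rewrite gt_eqF.
  rewrite max_r ?ler_expR ?lerN2 ?ler_pM2l ?ltW// expRK opprK mulrC mulKf ?gt_eqF//.
  by rewrite !gN// ltW.
apply: integral_cvg_squeeze => //.
  by apply: measurable_funTS; exact: continuous_measurable_fun.
move=> e e0.
have [n hn] := bernstein_approx ch (fun y => gB _) e0.
exists (fun w => bernstein n (fun i => h (i%:R / n%:R)) (expR (- (c * w)))).
exists (fun=> e); split.
- exact: integral_cvg_bernstein.
- exact: integral_cvg_cst.
- move=> w; rewrite /= in_itv/= andbT => w0.
  rewrite -hE; apply: hn; rewrite expR_ge0 -expR0 ler_expR oppr_le0.
  by rewrite mulr_ge0// ltW.
- rewrite (_ : \int[mu]_(_ in D) e = \int[mu]_(w in D) (e * (w : R) ^+ 0)); last first.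
    by apply: eq_Rintegral => w _; rewrite mulr1.
  rewrite RintegralZl//; last by case: (moment_cvg 0).
  by rewrite (momentE 0) fact0 expr0 divr1 mulr1.
Qed.

Lemma integral_cvg_bounded_continuous (f : R -> R) (B : R) : continuous f ->
  (forall w, `|f w| <= B) -> integral_cvg f.
Proof.
move=> cf fB.
have B0 : 0 <= B by exact: le_trans (fB 0).
apply: integral_cvg_squeeze => //.
  by apply: measurable_funTS; exact: continuous_measurable_fun.
move=> e e0.
(* Markov's inequality: cutting off beyond [N] costs at most [B / N * w], of limit integral
   [B / (N * l) <= e]. The summand 1 keeps [N] positive when [B = 0]. *)
pose N := B / (l * e) + 1.
have N0 : 0 < N by rewrite ltr_wpDl// divr_ge0// mulr_ge0// ltW.
pose chi (w : R) := Num.min 1 (Num.max 0 (N + 1 - w)).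
have chi01 w : 0 <= chi w <= 1.
  by rewrite /chi le_min ler01 le_max lexx/= ge_min lexx.
exists (fun w => f w * chi w), (fun w => B / N * w); split.
- apply: (@integral_cvg_vanishing _ B (N + 1)).
  + move=> w; apply: continuousM; first exact: cf.
    apply: (@continuous_min R R (cst 1) (fun w => Num.max 0 (N + 1 - w))).
      exact: cvg_cst.
    apply: (@continuous_max R R (cst 0) (fun w => N + 1 - w)).
      exact: cvg_cst.
    by apply: (@cvgB R R); [exact: cvg_cst|exact: cvg_id].
  + move=> w; rewrite normrM -[B]mulr1; apply: ler_pM => //.
    by have /andP[? ?] := chi01 w; rewrite ger0_norm.
  + by move=> w Nw; rewrite /chi max_l ?subr_le0// min_r ?ler01// mulr0.
- by apply: integral_cvg_ext (integral_cvgZ FF mD (B / N) (moment_cvg 1)) => w.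
- move=> w; rewrite /= in_itv/= andbT => w0.
  have -> : f w - f w * chi w = f w * (1 - chi w) by ring.
  have [wN|Nw] := leP w N.
    rewrite /chi max_r; last by rewrite subr_ge0 (le_trans wN)// lerDl.
    rewrite min_l; last by rewrite addrAC lerDr subr_ge0.
    by rewrite subrr mulr0 normr0 mulr_ge0// divr_ge0// ltW.
  rewrite normrM mulrAC -mulrA; apply: ler_pM => //.
  rewrite (@le_trans _ _ 1)//.
    by have /andP[? ?] := chi01 w; rewrite ger0_norm ?subr_ge0// lerBlDr lerDl.
  by rewrite ler_pdivlMr// mul1r ltW.
- rewrite RintegralZl//; last by case: (moment_cvg 1).
  have -> : \int[mu]_(w in D) (w : R) = l^-1.
    by rewrite (momentE 1) expr1 div1r.
  rewrite -mulrA -invfM ler_pdivrMr ?mulr_gt0// /N.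
  have -> : e * ((B / (l * e) + 1) * l) = B + e * l.
    by field; rewrite !gt_eqF.
  by rewrite lerDl mulr_ge0// ltW.
Qed.

End exponential_moments_method.

(** * Moments of the exponential distribution *)

Section exponential_moments.
Context {R : realType}.
Variables (l : R) (l0 : 0 < l).
Local Notation mu := (@lebesgue_measure R).
Local Notation D := (`[0%R, +oo[%classic : set R).

(* The primitive of l w^k exp(- l w) that vanishes at infinity. *)
Fixpoint gamma_primitive k (w : R) : R :=
  if k is k'.+1 then
    k'.+1%:R / l * gamma_primitive k' w - w ^+ k'.+1 * expR (- (l * w))
  else - expR (- (l * w)).

Lemma is_derive_expRNM (w : R) :
  is_derive w 1 (fun w => expR (- (l * w))) (- l * expR (- (l * w))).
Proof.
have dl : is_derive w (1 : R) (fun w : R => - (l * w)) (- l).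
  have := is_deriveN (is_deriveZ l (is_derive_id w (1 : R))).
  by move/is_derive_eq; apply; rewrite /GRing.scale/= mulr1.
have := @is_derive1_comp R expR _ w _ _ (is_derive_expR _) dl.
by move/is_derive_eq; apply; rewrite mulrC.
Qed.

Lemma is_derive_gamma_primitive k (w : R) :
  is_derive w 1 (gamma_primitive k) (l * (w ^+ k * expR (- (l * w)))).
Proof.
elim: k => [|k IHk].
  have := is_deriveN (is_derive_expRNM w).
  by move/is_derive_eq; apply; rewrite mulNr opprK mul1r.
have := is_deriveB (is_deriveZ (k.+1%:R / l) IHk)
  (is_deriveM (is_deriveX k.+1 (is_derive_id w (1 : R))) (is_derive_expRNM w)).
rewrite (_ : _ - _ = gamma_primitive k.+1); last first.
  by apply/funext => x; rewrite !fctE.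
move/is_derive_eq; apply; rewrite /GRing.scale/= !fctE/= exprS.
by field; rewrite gt_eqF.
Qed.

Lemma cvg_exprMexpRN k : w ^+ k * expR (- (l * w)) @[w --> +oo] --> (0 : R).
Proof.
(* The exponential is bounded below by its term of degree [k.+1], one more than the power to be
   beaten; what remains is this multiple of [w^-1]. *)
have inv0 : k.+1`!%:R / l ^+ k.+1 * w^-1 @[w --> +oo] --> (0 : R).
  rewrite -[X in _ --> X](mulr0 (k.+1`!%:R / l ^+ k.+1)).
  apply: cvgMl_tmp; apply/gtr0_cvgV0; last exact: cvg_id.
  exact: nbhs_pinfty_gt.
apply: (squeeze_cvgr _ (cvg_cst 0) inv0); near=> w.
have w0 : 0 < w by near: w; exact: nbhs_pinfty_gt.
have lw0 : 0 < l * w by rewrite mulr_gt0.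
apply/andP; split; first by rewrite mulr_ge0 ?expR_ge0// exprn_ge0// ltW.
rewrite expRN.
have := @expR_ge1Dxn R (l * w) k (ltW lw0).
move=> /(le_trans _) H.
have {}H : (l * w) ^+ k.+1 / k.+1`!%:R <= expR (l * w).
  by apply: H; rewrite lerDr.
have pos : 0 < (l * w) ^+ k.+1 / k.+1`!%:R.
  by rewrite divr_gt0 ?exprn_gt0// ltr0n fact_gt0.
rewrite (@le_trans _ _ (w ^+ k * ((l * w) ^+ k.+1 / k.+1`!%:R)^-1))//.
  apply: ler_wpM2l; first by rewrite exprn_ge0// ltW.
  by rewrite lef_pV2// posrE expR_gt0.
rewrite invf_div exprMn le_eqVlt; apply/orP; left; apply/eqP.
by rewrite [w ^+ k.+1]exprS; field; rewrite ?expf_neq0 ?gt_eqF.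
Unshelve. all: end_near. Qed.

Lemma cvg_gamma_primitive k : gamma_primitive k w @[w --> +oo] --> (0 : R).
Proof.
elim: k => [|k IHk] /=.
  rewrite -oppr0; apply: cvgN.
  by have := cvg_exprMexpRN 0; under eq_fun do rewrite mul1r.
rewrite -(subr0 (0 : R)); apply: (@cvgB R R); last exact: (cvg_exprMexpRN k.+1).
by rewrite -[X in _ --> X](mulr0 (k.+1%:R / l)); apply: cvgMl_tmp.
Qed.

Lemma gamma_primitive0 k : gamma_primitive k 0 = - (k`!%:R / l ^+ k).
Proof.
elim: k => [|k IHk] /=; first by rewrite mulr0 oppr0 expR0 fact0 expr0 divr1.
rewrite IHk expr0n mul0r subr0 factS natrM exprS.
by field; rewrite ?expf_neq0 gt_eqF.
Qed.

Lemma integral_gamma k :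
  (\int[mu]_(w in D) (l * (w ^+ k * expR (- (l * w))))%:E =
   (k`!%:R / l ^+ k)%:E)%E.
Proof.
rewrite (@ge0_continuous_FTC2y _ _ (gamma_primitive k) _ 0).
- by rewrite gamma_primitive0 -EFinB sub0r opprK.
- by move=> w w0; rewrite !mulr_ge0 ?expR_ge0 ?exprn_ge0// ltW.
- apply: continuous_subspaceT => w; apply: cvgMl_tmp; apply: cvgM.
    exact: exprn_continuous.
  apply: (@continuous_comp R R R (fun w => - (l * w)) expR).
    by apply: (@cvgN R R); apply: cvgMl_tmp; exact: cvg_id.
  exact: continuous_expR.
- exact: cvg_gamma_primitive.
- by move=> w _; have := is_derive_gamma_primitive k w => /@ex_derive.
- apply: cvg_at_right_filter.
  have := is_derive_gamma_primitive k 0 => /@ex_derive.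
  by move/derivable1_diffP/differentiable_continuous.
- by move=> w _; rewrite derive1E; have := is_derive_gamma_primitive k w => /@derive_val.
Qed.

(** Change of variables produces the Radon-Nikodym derivative, which agrees with [exponential_pdf]
    almost everywhere because both have the same integral over every measurable set. *)
Lemma ge0_integral_exponential_prob (f : R -> R) (E : set R) :
  (forall w, 0 <= f w) -> measurable E -> measurable_fun E f ->
  (\int[exponential_prob l]_(w in E) (f w)%:E =
   \int[mu]_(w in E) (f w * exponential_pdf l w)%:E)%E.
Proof.
move=> f0 mE mf.
have mpdf : measurable_fun [set: R] (EFin \o exponential_pdf l).
  by apply/measurable_EFinP; apply: measurable_exponential_pdf; exact: ltW.
have dom : exponential_prob l `<< mu.
  apply/null_content_dominatesP => /= A mA A0.
  apply: null_set_integral => //.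
  exact: measurable_funTS.
rewrite -(Radon_Nikodym_SigmaFinite.change_of_variables dom)//; last first.
  exact/measurable_EFinP.
under [RHS]eq_integral do rewrite EFinM.
apply: ae_eq_integral => //.
- apply: emeasurable_funM; first exact/measurable_EFinP.
  apply: measurable_funTS; apply: (measurable_int mu).
  exact: Radon_Nikodym_SigmaFinite.f_integrable.
- by apply: emeasurable_funM; [exact/measurable_EFinP|exact: measurable_funTS].
- apply: ae_eqe_mul2l.
  apply: (@ae_eq_subset _ _ _ _ mu setT E) => //.
  apply: integral_ae_eq => //.
  + exact: Radon_Nikodym_SigmaFinite.f_integrable.
  + by move=> A _ mA; rewrite -Radon_Nikodym_SigmaFinite.f_integral.
Qed.

Lemma integral_exponential_prob_expn k :
  (\int[exponential_prob l]_(w in D) (w ^+ k)%:E = (k`!%:R / l ^+ k)%:E)%E.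
Proof.
have mX : measurable_fun D (fun w : R => w ^+ k).
  by apply: measurable_funTS; exact: exprn_measurable.
rewrite -integral_gamma.
(* The change of density asks for a function nonnegative everywhere, and odd powers are negative
   outside [D]. *)
rewrite (eq_integral (fun w : measurableTypeR R => (`|w ^+ k|)%:E)); last first.
  by move=> w; rewrite inE/= in_itv/= andbT => w0; rewrite ger0_norm ?exprn_ge0.
rewrite ge0_integral_exponential_prob//; last exact: measurableT_comp.
apply: eq_integral => w; rewrite inE/= in_itv/= andbT => w0; congr EFin.
by rewrite exponential_pdfE// ger0_norm ?exprn_ge0// mulrCA mulNr.
Qed.

End exponential_moments.

(** * From convergence of moments to weak convergence *)

Section weak_convergence.
Context {R : realType}.
Local Notation Rm := (measurableTypeR R).
Local Notation D := (`[0%R, +oo[%classic : set Rm).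

Lemma integral_nonneg_supported (nu : {measure set Rm -> \bar R}) (f : R -> R) :
  nu `]-oo, 0[%classic = 0%E -> continuous f ->
  (\int[nu]_w (f w)%:E = \int[nu]_(w in D) (f w)%:E)%E.
Proof.
move=> nu0 cf.
have mf : measurable_fun [set: Rm] (EFin \o f).
  by apply/measurable_EFinP; exact: continuous_measurable_fun.
have DE : D = ~` (`]-oo, 0[%classic : set Rm).
  by apply/seteqP; split => w /=; rewrite !in_itv/= andbT leNgt => /negP.
rewrite -(setUv (`]-oo, 0[%classic : set Rm)) integral_setU//.
- rewrite (null_set_integral _ _ nu0)// ?add0e -?DE//.
  exact: measurable_funTS.
- exact: measurableC.
- by rewrite setUv.
- exact/disj_setPCl.
Qed.

Lemma moment_cvg_weak_cvg_exponential (I : Type) (F : set_system I)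
    (FF : Filter F) (m : I -> {measure set Rm -> \bar R}) (l : R) : 0 < l ->
  (\forall i \near F, m i `]-oo, 0[%classic = 0%E) ->
  (forall k, \forall i \near F, (m i).-integrable D (fun w : R => (w ^+ k)%:E)) ->
  (forall k, \int[m i]_(w in D) ((w : R) ^+ k) @[i --> F] --> k`!%:R / l ^+ k) ->
  weak_cvg F m (exponential_prob l).
Proof.
move=> l0 m_nneg m_int m_cvg f cf [M [_ HM]].
have fB w : `|f w| <= M + 1 by apply: HM => //; rewrite ltrDl.
(* The measure structure on [exponential_prob l] depends on the proof [l0], so the instance is
   applied to it by name. *)
pose mu := exponential_distribution_exponential_prob__canonical__measure_function_Measure l0.
have momentE k : \int[mu]_(w in D) ((w : R) ^+ k) = k`!%:R / l ^+ k.
  by rewrite /Rintegral integral_exponential_prob_expn.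
have moment_cvg k : integral_cvg F m mu D (fun w : R => w ^+ k).
  split; [|exact: m_int|by rewrite momentE; exact: m_cvg].
  apply/integrableP; split.
    by apply/measurable_EFinP/measurable_funTS; exact: exprn_measurable.
  rewrite (eq_integral (fun w : Rm => ((w : R) ^+ k)%:E)).
    by rewrite integral_exponential_prob_expn// ltry.
  move=> w; rewrite inE/= in_itv/= andbT => w0.
  by rewrite ger0_norm ?exprn_ge0.
have [f1 f2 f3] := integral_cvg_bounded_continuous FF l0 moment_cvg momentE erefl cf fB.
have mu0 : mu `]-oo, 0[%classic = 0%E.
  rewrite /mu/= /exponential_prob integral0_eq// => w /=; rewrite in_itv/= => w0.
  by rewrite lt0_exponential_pdf.
rewrite (integral_nonneg_supported mu0 cf).
have -> : (\int[mu]_(w in D) (f w)%:E)%E = (\int[mu]_(w in D) f w)%:E.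
  by rewrite fineK//; exact: integrable_fin_num.
have : (\int[m i]_(w in D) f w)%:E @[i --> F] --> (\int[mu]_(w in D) f w)%:E.
  by apply/fine_cvgP; split; [exact: nearW|exact: f3].
apply: cvg_trans; apply: near_eq_cvg; near=> i.
rewrite integral_nonneg_supported//; last by near: i.
by rewrite fineK//; apply: integrable_fin_num => //; near: i.
Unshelve. all: end_near. Qed.

End weak_convergence.

(** * Fourier transform of the Gaussian *)

Section gaussian_fourier.
Context {R : realType}.
Local Notation mu := (@lebesgue_measure R).

Definition gaussian (x : R) := expR (- (x ^+ 2 / 2)).

Lemma gaussian_ge0 x : 0 <= gaussian x. Proof. exact: expR_ge0. Qed.

Lemma normal_funE (s x : R) : normal_fun 0 s x = expR (- (x ^+ 2 / (s ^+ 2 * 2))).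
Proof. by rewrite /normal_fun subr0 mulNr mulr_natr. Qed.

Lemma normal_pdfE0 (s : R) : s != 0 ->
  normal_pdf 0 s = (fun x => normal_peak s * expR (- (x ^+ 2 / (s ^+ 2 * 2)))).
Proof. by move=> s0; rewrite normal_pdfE//; apply/funext => x; rewrite normal_funE. Qed.

Lemma integrable_expRN_sqr (s : R) : s != 0 ->
  mu.-integrable setT (fun x => (expR (- (x ^+ 2 / (s ^+ 2 * 2))))%:E).
Proof.
move=> s0; have p0 := normal_peak_gt0 s0.
have := integrableZl measurableT (normal_peak s)^-1 (@integrable_normal_pdf R 0 s).
apply: eq_integrable => // x _.
by rewrite -EFinM normal_pdfE0// mulKf// gt_eqF.
Qed.

Lemma integrable_gaussian : mu.-integrable setT (EFin \o gaussian).
Proof.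
have := @integrable_expRN_sqr 1 (oner_neq0 _).
by apply: eq_integrable => // x _; rewrite expr1n mul1r.
Qed.

Lemma integral_gaussian :
  (\int[mu]_x (gaussian x)%:E = (Num.sqrt (2 * pi))%:E)%E.
Proof.
have p0 := normal_peak_gt0 (oner_neq0 R).
have := @integral_normal_pdf R 0 1.
under eq_integral do rewrite normal_pdfE0 ?oner_eq0// expr1n mul1r EFinM.
rewrite integralZl//; last exact: integrable_gaussian.
rewrite -[X in (_ * X)%E = _]/(\int[mu]_x (gaussian x)%:E)%E => H.
have -> : (\int[mu]_x (gaussian x)%:E = (normal_peak 1)^-1%:E *
    ((normal_peak 1)%:E * \int[mu]_x (gaussian x)%:E))%E.
  by rewrite muleA -EFinM mulVf ?mul1e// gt_eqF.
rewrite H mule1 /normal_peak invrK expr1n mul1r.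
by rewrite mulr_natl.
Qed.

Lemma Rintegral_gaussian : \int[mu]_x gaussian x = Num.sqrt (2 * pi).
Proof. by rewrite /Rintegral integral_gaussian. Qed.

Lemma continuous_gaussian : continuous gaussian.
Proof.
move=> x; apply: (@continuous_comp R R R (fun x => - (x ^+ 2 / 2)) expR).
  by apply: (@cvgN R R); apply: cvgMr_tmp; exact: exprn_continuous.
exact: continuous_expR.
Qed.

Lemma measurable_gaussian : measurable_fun [set: R] gaussian.
Proof. exact: continuous_measurable_fun continuous_gaussian. Qed.

(** Half of the exponent absorbs [|x|], since [|x| <= 1 + x^2 / 4 <= exp (x^2 / 4)]. The other half
    is the Gaussian of variance 2, written in the shape of [integrable_expRN_sqr]. *)
Lemma normM_gaussian_le (x : R) :
  `|x| * gaussian x <= expR (- (x ^+ 2 / (Num.sqrt 2 ^+ 2 * 2))).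
Proof.
rewrite sqr_sqrtr//.
have -> : gaussian x = expR (- (x ^+ 2 / (2 * 2))) / expR (x ^+ 2 / (2 * 2)).
  by rewrite -expRN -expRD; congr expR; field.
rewrite mulrA ler_pdivrMr ?expR_gt0// mulrC ler_wpM2l ?expR_ge0//.
apply: le_trans (expR_ge1Dx _).
rewrite -[x ^+ 2]real_normK ?num_real//.
have := sqr_ge0 (`|x| / 2 - 1); lra.
Qed.

Lemma integrable_normM_gaussian :
  mu.-integrable setT (fun x : R => (`|x| * gaussian x)%:E).
Proof.
have s0 : Num.sqrt 2 != 0 :> R by rewrite gt_eqF// sqrtr_gt0.
apply: le_integrable (integrable_expRN_sqr s0) => //.
  apply/measurable_EFinP; apply: measurable_funM; last exact: measurable_gaussian.
  exact: normr_measurable.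
move=> x _ /=; rewrite lee_fin ger0_norm ?mulr_ge0 ?gaussian_ge0//.
by rewrite [leRHS]ger0_norm ?expR_ge0// normM_gaussian_le.
Qed.

Lemma is_derive_gaussian (x : R) : is_derive x 1 gaussian (- x * gaussian x).
Proof.
have d1 : is_derive x (1 : R) (fun x : R => - (x ^+ 2 / 2)) (- x).
  have := is_deriveN (is_deriveZ (2^-1) (is_deriveX 2 (is_derive_id x (1 : R)))).
  rewrite (_ : - _ = fun x : R => - (x ^+ 2 / 2)); last first.
    by apply/funext => y; rewrite !fctE /GRing.scale/= mulrC.
  by move/is_derive_eq; apply; rewrite /GRing.scale/= expr1; field.
have := @is_derive1_comp R expR _ x _ _ (is_derive_expR _) d1.
by move/is_derive_eq; apply; rewrite mulrC.
Qed.

Lemma is_derive_scale (a x : R) : is_derive x (1 : R) (fun x : R => a * x) a.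
Proof.
have := is_deriveZ a (is_derive_id x (1 : R)).
by move/is_derive_eq; apply; rewrite /GRing.scale/= mulr1.
Qed.

Lemma is_derive_gaussian_sin (a x : R) :
  is_derive x 1 (fun x => gaussian x * sin (a * x))
    (a * (gaussian x * cos (a * x)) - x * gaussian x * sin (a * x)).
Proof.
have ds := @is_derive1_comp R sin _ x _ _ (is_derive_sin _) (is_derive_scale a x).
have := is_deriveM (is_derive_gaussian x) ds.
by move/is_derive_eq; apply; rewrite /GRing.scale/=; ring.
Qed.

Lemma continuous_cosM (a : R) : continuous (fun x : R => cos (a * x)).
Proof.
move=> x; apply: (@continuous_comp R R R (fun x => a * x) cos).
  by apply: cvgMl_tmp; exact: cvg_id.
exact: continuous_cos.
Qed.

Lemma continuous_sinM (a : R) : continuous (fun x : R => sin (a * x)).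
Proof.
move=> x; apply: (@continuous_comp R R R (fun x => a * x) sin).
  by apply: cvgMl_tmp; exact: cvg_id.
exact: continuous_sin.
Qed.

Lemma sin_le1_norm (x : R) : `|sin x| <= 1.
Proof. by rewrite ler_norml sin_geN1 sin_le1. Qed.

Lemma cos_le1_norm (x : R) : `|cos x| <= 1.
Proof. by rewrite ler_norml cos_geN1 cos_le1. Qed.

Lemma integrable_gaussianM (h : R -> R) : measurable_fun setT h ->
  (forall x, `|h x| <= 1) ->
  mu.-integrable setT (fun x => (gaussian x * h x)%:E).
Proof.
move=> mh h1; apply: le_integrable integrable_gaussian => //.
  by apply/measurable_EFinP; apply: measurable_funM => //; exact: measurable_gaussian.
move=> x _ /=; rewrite lee_fin normrM ler_piMr//.
Qed.

Lemma integrable_gaussian_idM (h : R -> R) : measurable_fun setT h ->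
  (forall x, `|h x| <= 1) ->
  mu.-integrable setT (fun x => (x * gaussian x * h x)%:E).
Proof.
move=> mh h1; apply: le_integrable integrable_normM_gaussian => //.
  apply/measurable_EFinP; apply: measurable_funM => //.
  by apply: measurable_funM => //; exact: measurable_gaussian.
move=> x _ /=; rewrite lee_fin !normrM normr_id ler_piMr// mulr_ge0//.
Qed.

Lemma cvg_gaussian : gaussian n%:R @[n --> \oo] --> (0 : R).
Proof.
have inv0 : (n.+1%:R : R)^-1 * 2 @[n --> \oo] --> (0 : R).
  by rewrite -[X in _ --> X](mul0r 2); apply: cvgMr_tmp; exact: cvg_harmonic.
have nn2 k : (k%:R : R) <= k%:R ^+ 2.
  by rewrite -natrX ler_nat; case: k => // k; rewrite expnS expn1 leq_pmulr.
apply: (squeeze_cvgr _ (cvg_cst 0) inv0); near=> n.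
rewrite gaussian_ge0/= /gaussian expRN.
have n2 : 0 < 1 + n%:R ^+ 2 / 2 :> R by rewrite ltr_pwDl// divr_ge0// sqr_ge0.
rewrite (@le_trans _ _ (1 + n%:R ^+ 2 / 2)^-1)//.
  by rewrite lef_pV2 ?posrE ?expR_gt0// expR_ge1Dx.
rewrite -[leLHS]mul1r ler_pdivrMr// -mulrA [leRHS]mulrC ler_pdivlMr ?ltr0n//.
rewrite mul1r -natr1.
have := nn2 n; lra.
Unshelve. all: end_near. Qed.

(* The integrand is the derivative of gaussian x * sin (a * x). For the Fourier
   transform Phi of the Gaussian this reads Phi' = - a Phi. *)
Lemma Rintegral_gaussian_sin_derive (a : R) :
  \int[mu]_x (a * (gaussian x * cos (a * x)) - x * gaussian x * sin (a * x)) = 0.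
Proof.
pose F (x : R) := gaussian x * sin (a * x).
pose f (x : R) := a * (gaussian x * cos (a * x)) - x * gaussian x * sin (a * x).
have cf : continuous f.
  move=> x; apply: (@cvgB R R).
    apply: cvgMl_tmp; apply: cvgM; [exact: continuous_gaussian|exact: continuous_cosM].
  apply: cvgM; last exact: continuous_sinM.
  by apply: cvgM; [exact: cvg_id|exact: continuous_gaussian].
have mf : measurable_fun [set: R] f by exact: continuous_measurable_fun.
have mc : measurable_fun [set: R] (fun x => cos (a * x)).
  by apply: continuous_measurable_fun; exact: continuous_cosM.
have ms : measurable_fun [set: R] (fun x => sin (a * x)).
  by apply: continuous_measurable_fun; exact: continuous_sinM.
have i1 := integrableZl measurableT a (integrable_gaussianM mc (fun x => cos_le1_norm _)).
have i2 := integrable_gaussian_idM ms (fun x => sin_le1_norm _).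
have intf : mu.-integrable setT (EFin \o f) := integrableB measurableT i1 i2.
(* Symmetric intervals, nondegenerate thanks to [n.+1]. The primitive is odd, so its increment is
   twice the value at the right end. *)
pose J n : set R := `[- (n.+1%:R : R), n.+1%:R]%classic.
have FTC n : (\int[mu]_(x in J n) (f x)%:E =
    (gaussian n.+1%:R * sin (a * n.+1%:R) * 2)%:E)%E.
  have nn : - n.+1%:R < n.+1%:R :> R by rewrite ltrNl (lt_trans (y := 0))// ?oppr_lt0.
  have dF (x : R) : is_derive x 1 F (f x) by exact: is_derive_gaussian_sin.
  have cF : continuous F.
    by move=> x; apply: cvgM; [exact: continuous_gaussian|exact: continuous_sinM].
  rewrite (@continuous_FTC2 _ f F)//.
  - rewrite -EFinB /F /gaussian sqrrN mulrN sinN; congr EFin; ring.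
  - exact: continuous_subspaceT.
  - split.
    + by move=> x _; have /@ex_derive := dF x.
    + by apply: cvg_at_right_filter; exact: cF.
    + by apply: cvg_at_left_filter; exact: cF.
  - by move=> x _; rewrite derive1E; have /@derive_val := dF x.
pose f_ n := (EFin \o f) \_ (J n).
have mf_ n : measurable_fun [set: R] (f_ n).
  apply/measurable_restrict => //; first exact: measurable_itv.
  by apply: measurable_funTS; exact/measurable_EFinP.
have [|||||_ _ lim_f] := @dominated_convergence _ _ _ mu setT measurableT f_ (EFin \o f)
  (fun x => `|(f x)%:E|%E).
- by [].
- exact/measurable_EFinP.
- apply: aeW => x _; apply: cvg_near_cst.
  exists (Num.truncn `|x|) => // n /= xn; rewrite /f_ patchE ifT// inE /J/= in_itv/=.
  rewrite -ler_norml (le_trans (ltW (truncnS_gt _)))// ler_nat ltnS//.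
- exact: integrable_norm.
- apply: aeW => x n _; rewrite /f_ patchE; case: ifPn => // _.
  by rewrite abse0.

have limF : (gaussian n.+1%:R * sin (a * n.+1%:R) * 2) @[n --> \oo] --> (0 : R).
  have g2 : gaussian n.+1%:R * 2 @[n --> \oo] --> (0 : R).
    rewrite -[X in _ --> X](mul0r 2); apply: cvgMr_tmp.
    by have := @cvg_gaussian; rewrite -(@cvg_shiftS _ (fun n => gaussian n%:R)).
  apply: norm_cvg0; apply: (squeeze_cvgr _ (cvg_cst 0) g2).
  apply: nearW => n; rewrite normr_ge0/= !normrM (ger0_norm (gaussian_ge0 _)).
  rewrite [`|2|]ger0_norm// ler_wpM2r// ler_piMr ?gaussian_ge0//.
  exact: sin_le1_norm.
have : (\int[mu]_x f_ n x)%E @[n --> \oo] --> 0%E.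
  have -> : (fun n => \int[mu]_x f_ n x)%E = (fun n =>
      (gaussian n.+1%:R * sin (a * n.+1%:R) * 2)%:E).
    by apply/funext => n; rewrite -FTC [RHS]integral_mkcond.
  by apply/fine_cvgP; split; [exact: nearW|exact: limF].
move=> /cvg_unique => /(_ (@ereal_hausdorff R) _ lim_f).
by rewrite /Rintegral => <-.
Qed.

(** Differentiation under the integral sign, with the majorant [|y| * gaussian y] for every
    parameter, gives [Phi' = - a Phi]. Then [Phi y * expR (y ^+ 2 / 2)] has derivative 0, so it
    keeps its value at 0, the Gaussian integral. *)
Lemma gaussian_fourier (x : R) :
  \int[mu]_y (gaussian y * cos (x * y)) = Num.sqrt (2 * pi) * gaussian x.
Proof.
pose Phi (x : R) := \int[mu]_y (gaussian y * cos (x * y)).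
have mc a : measurable_fun [set: R] (fun x => cos (a * x)).
  by apply: continuous_measurable_fun; exact: continuous_cosM.
have ms a : measurable_fun [set: R] (fun x => sin (a * x)).
  by apply: continuous_measurable_fun; exact: continuous_sinM.
have dcos y (z : R) : is_derive z 1 (fun z => gaussian y * cos (z * y))
    (- (y * gaussian y * sin (z * y))).
  have dz : is_derive z (1 : R) (fun z : R => z * y) y.
    rewrite (_ : (fun _ => _) = (fun z : R => y * z)); first exact: is_derive_scale.
    by apply/funext => u; rewrite mulrC.
  have dc := @is_derive1_comp R cos _ z _ _ (is_derive_cos _) dz.
  have := is_deriveZ (gaussian y) dc.
  by move/is_derive_eq; apply; rewrite /GRing.scale/=; ring.
have intc a : mu.-integrable setT (EFin \o (fun y => gaussian y * cos (a * y))).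
  by apply: integrable_gaussianM => // y; exact: cos_le1_norm.
have ints a : mu.-integrable setT (EFin \o (fun y => y * gaussian y * sin (a * y))).
  by apply: integrable_gaussian_idM => // y; exact: sin_le1_norm.
have dPhi (a : R) : is_derive a 1 Phi (- a * Phi a).
  have Ia : [set` `]a - 1, a + 1[%R] a.
    by rewrite /= in_itv/=; apply/andP; split; lra.
  pose f z y := gaussian y * cos (z * y).
  have df z y : derivable (f ^~ y) z 1 by have /@ex_derive := dcos y z.
  have G0 y : 0 <= `|y| * gaussian y by rewrite mulr_ge0 ?gaussian_ge0.
  have Gub z y : `|partial1of2 f z y| <= `|y| * gaussian y.
    rewrite partial1of2E; have /@derive_val -> := dcos y z.
    rewrite normrN !normrM (ger0_norm (gaussian_ge0 _)) ler_piMr//.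
    exact: sin_le1_norm.
  apply: DeriveDef.
    exact: (derivable_under_integral measurableT Ia (fun z _ => intc z)
      (fun z y _ _ => df z y) G0 integrable_normM_gaussian (fun z y _ _ => Gub z y)).
  rewrite -derive1E.
  rewrite (differentiation_under_integral measurableT Ia (fun z _ => intc z)
    (fun z y _ _ => df z y) G0 integrable_normM_gaussian (fun z y _ _ => Gub z y)).
  under eq_Rintegral => y _.
    rewrite partial1of2E; have /@derive_val -> := dcos y a.
    rewrite -mulN1r; over.
  rewrite RintegralZl//.
  have := Rintegral_gaussian_sin_derive a.
  rewrite RintegralB//; last exact: (integrableZl measurableT a (intc a)).
  rewrite RintegralZl// -/(Phi a) => /eqP; rewrite subr_eq0 => /eqP <-.
  by rewrite mulN1r mulNr.
have gV y : gaussian y * expR (y ^+ 2 / 2) = 1 by rewrite /gaussian -expRD addNr expR0.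
have dexp (y : R) : is_derive y 1 (fun y => expR (y ^+ 2 / 2)) (y * expR (y ^+ 2 / 2)).
  have d1 : is_derive y (1 : R) (fun x : R => x ^+ 2 / 2) y.
    have := is_deriveZ (2^-1) (is_deriveX 2 (is_derive_id y (1 : R))).
    rewrite (_ : 2^-1 \*: _ = fun x : R => x ^+ 2 / 2); last first.
      by apply/funext => u; rewrite !fctE /GRing.scale/= mulrC.
    by move/is_derive_eq; apply; rewrite /GRing.scale/= expr1; field.
  have := @is_derive1_comp R expR _ y _ _ (is_derive_expR _) d1.
  by move/is_derive_eq; apply; rewrite mulrC.
have cst : forall y, is_derive y (1 : R) (fun y => Phi y * expR (y ^+ 2 / 2)) 0.
  move=> y; have := is_deriveM (dPhi y) (dexp y).
  by move/is_derive_eq; apply; rewrite /GRing.scale/=; ring.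
have := is_derive_0_is_cst x 0 cst.
rewrite expr0n mul0r expR0 mulr1 {2}/Phi.
under [in RHS]eq_Rintegral do rewrite mul0r cos0 mulr1.
rewrite Rintegral_gaussian => <-.
by rewrite -mulrA [expR _ * _]mulrC gV mulr1.
Qed.

End gaussian_fourier.

(** * Lebesgue measure on tuples *)

Section lebesgue_tuple.
Context {R : realType}.
Local Notation Rm := (measurableTypeR R).
Local Notation mu := (@lebesgue_measure R).

(** A separate constant, so that sigma-finiteness, proved below for the whole product, can be
    attached to it as an instance. *)
Definition lebesgue_tuple n : set (n.-tuple Rm) -> \bar R :=
  tuple_measure (fun _ : 'I_n => mu).

HB.instance Definition _ n := Measure.on (@lebesgue_tuple n).

Lemma lebesgue_tupleS n (A : set (n.+1.-tuple Rm)) :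
  lebesgue_tuple A = (lebesgue_tuple (n := n) \x mu)%E (@tuple_cons R n @^-1` A).
Proof. by []. Qed.

Definition tuple_box n (N : nat) : set (n.-tuple Rm) :=
  [set k | forall i, `|tnth k i : R| <= N%:R].

Lemma measurable_tuple_box n N : measurable (tuple_box (n := n) N).
Proof.
rewrite (_ : tuple_box _ = \bigcap_(i : 'I_n)
  ((fun k : n.-tuple Rm => tnth k i : R) @^-1` `[- N%:R, N%:R]%classic)); last first.
  apply/seteqP; split => k /= Hk i.
    by move=> _ /=; rewrite in_itv/= -ler_norml.
  by have /= := Hk i I; rewrite in_itv/= -ler_norml.
apply: fin_bigcap_measurable => // i _.
rewrite -[X in measurable X]setTI; apply: measurable_tnth => //.
Qed.

Lemma lebesgue_tuple_box n N : (lebesgue_tuple (tuple_box (n := n) N) < +oo)%E.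
Proof.
elim: n => [|n IHn]; first by rewrite /lebesgue_tuple/= diracE ltry.
rewrite lebesgue_tupleS.
rewrite (_ : _ @^-1` _ = tuple_box (n := n) N `*` `[- N%:R, N%:R]%classic); last first.
  apply/seteqP; split => -[v x] /=.
    move=> H; split => [i|]; first by have := H (lift ord0 i); rewrite tnthS.
    by have := H ord0; rewrite in_itv/= -ler_norml.
  move=> [Hv]; rewrite in_itv/= -ler_norml => Hx i.
  by case: (unliftP ord0 i) => [j|] ->; rewrite ?tnthS.
rewrite product_measure1E//; last exact: measurable_tuple_box.
rewrite lte_mul_pinfty// ?ge0_fin_numE//.
suff : (mu [set` `[(- N%:R)%R, N%:R]%R] < +oo)%E by [].
by rewrite lebesgue_measure_itv/=; case: ifP => _; rewrite ?ltry// -EFinD ltry.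
Qed.

Lemma sigma_finite_lebesgue_tuple n : sigma_finite setT (@lebesgue_tuple n).
Proof.
exists (fun N => tuple_box (n := n) N); last first.
  by move=> N; split; [exact: measurable_tuple_box|exact: lebesgue_tuple_box].
apply/seteqP; split => // k _.
exists (\max_(i < n) (Num.truncn `|tnth k i : R|).+1)%N => // i.
rewrite (le_trans (ltW (truncnS_gt _)))// ler_nat.
exact: (bigop.bigmax_sup i).
Qed.

HB.instance Definition _ n := Measure_isSigmaFinite.Build _ _ _
  (@lebesgue_tuple n) (@sigma_finite_lebesgue_tuple n).

Lemma ge0_integral_lebesgue_tupleS n (f : n.+1.-tuple Rm -> \bar R) :
  measurable_fun setT f -> (forall k, 0 <= f k)%E ->
  (\int[@lebesgue_tuple n.+1]_k f k =
   \int[@lebesgue_tuple n]_v \int[mu]_x f (tuple_cons (v, x)))%E.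
Proof.
move=> mf f0.
have mc := @measurable_tuple_cons R n.
rewrite -(fubini_tonelli1 (f \o @tuple_cons R n)).
(* By definition, [tuple_measure] at [n.+1] is the image of a product measure under [tuple_cons]. *)
- rewrite -[LHS]/(\int[pushforward (@lebesgue_tuple n \x mu)%E (@tuple_cons R n)]_k
    f k)%E.
  by rewrite (ge0_integral_pushforward mc).
- exact: (measurableT_comp mf mc).
- by move=> v; exact: f0.
Qed.

Lemma integral_lebesgue_tupleS n (f : n.+1.-tuple Rm -> R) :
  (@lebesgue_tuple n.+1).-integrable setT (EFin \o f) ->
  (\int[@lebesgue_tuple n.+1]_k (f k)%:E =
   \int[@lebesgue_tuple n]_v \int[mu]_x (f (tuple_cons (v, x)))%:E)%E.
Proof.
move=> intf; have mf := measurable_int _ intf.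
have mc := @measurable_tuple_cons R n.
have intf' : (@lebesgue_tuple n \x mu)%E.-integrable setT
    (EFin \o f \o @tuple_cons R n).
  apply/integrableP; split; first exact: measurableT_comp.
  have /integrableP[_] := intf.
  rewrite (ge0_integral_pushforward mc)//=.
  by apply/measurable_EFinP; apply: measurableT_comp => //; exact/measurable_EFinP.
rewrite -[LHS]/(\int[pushforward (@lebesgue_tuple n \x mu)%E (@tuple_cons R n)]_k
  (EFin \o f) k)%E.
rewrite (integral_pushforward mc)//.
by rewrite -(integral12_prod_meas1 intf').
Qed.

Lemma measurable_tuple_map n (g : R -> R) : measurable_fun setT g ->
  measurable_fun setT (fun k : n.-tuple Rm => [tuple of map g k] : n.-tuple Rm).
Proof.
move=> mg; apply/measurable_fun_tnthP => i.
rewrite (_ : _ \o _ = g \o (fun k : n.-tuple Rm => tnth k i)).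
  by apply: measurableT_comp => //; exact: measurable_tnth.
by apply/funext => k /=; rewrite tnth_map.
Qed.

End lebesgue_tuple.

(** * Change of variables on the line *)

Section dilation.
Context {R : realType}.
Local Notation Rm := (measurableTypeR R).
Local Notation mu := (@lebesgue_measure R).

(** Uniqueness of Lebesgue measure reduces this to the intervals []a, b]]. A negative [c] reverses
    them into [[b / c, a / c[]; that case provides the reflection used for odd functions. *)
Lemma lebesgue_measure_dilation (c : R) (A : set Rm) : c != 0 -> measurable A ->
  (mu A = (`|c|)%:E * mu (dilation c @^-1` A))%E.
Proof.
move=> c0 mA.
pose nu := mscale (NngNum (normr_ge0 c)) (image_measure mu (dilation c)).
rewrite -[RHS]/(nu A).
apply: (@lebesgue_measure_unique R nu) => // X /ocitvP[->|[[a b] /= ab ->]].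
  by rewrite !measure0.
rewrite lebesgue_measure_itv/= lte_fin ab /nu /mscale/= /image_measure /pushforward.
have [cp|cn] := ltP 0 c.
  rewrite (_ : _ @^-1` _ = `]a / c, b / c]%classic); last first.
    apply/seteqP; split => x /=;
    by rewrite /dilation !in_itv/= ltr_pdivrMr// ler_pdivlMr// mulrC.
  rewrite lebesgue_measure_itv/= lte_fin ltr_pM2r ?invr_gt0// ab -!EFinB -EFinM.
  by congr EFin; rewrite gtr0_norm//; field.
have {}cn : c < 0 by rewrite lt_neqAle c0.
rewrite (_ : _ @^-1` _ = `[b / c, a / c[%classic); last first.
  apply/seteqP; split => x /=;
  by rewrite /dilation !in_itv/= ltr_ndivlMr// ler_ndivrMr// mulrC andbC.
rewrite lebesgue_measure_itv/= lte_fin ltr_nM2r ?invr_lt0// ab -!EFinB -EFinM.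
by congr EFin; rewrite ltr0_norm//; field.
Qed.

Lemma ge0_integral_dilation (c : R) (f : R -> \bar R) : c != 0 ->
  measurable_fun [set: Rm] f -> (forall x, 0 <= f x)%E ->
  (\int[mu]_x f x = (`|c|)%:E * \int[mu]_x f (c * x)%R)%E.
Proof.
move=> c0 mf f0; have mc := @measurable_dilation R c.
have -> : (\int[mu]_x f (c * x)%R = \int[pushforward mu (dilation c)]_x f x)%E.
  by rewrite (ge0_integral_pushforward mc).
rewrite -(ge0_integral_mscale _ _ (NngNum (normr_ge0 c)))//.
by apply: eq_measure_integral => A mA _; exact: lebesgue_measure_dilation.
Qed.

Lemma Rintegral_odd (f : R -> R) : (forall x, f (- x) = - f x) ->
  mu.-integrable setT (EFin \o f) -> \int[mu]_x f x = 0.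
Proof.
move=> fN intf; have mf := measurable_int _ intf.
have mc := @measurable_dilation R (-1).
have E : \int[mu]_x f x = \int[mu]_x (-1 * f x).
  congr fine.
  transitivity (\int[pushforward mu (dilation (-1))]_x (f x)%:E)%E.
    apply: eq_measure_integral => A mA _.
    have N1 : (-1 : R) != 0 by rewrite oppr_eq0 oner_eq0.
    by have := lebesgue_measure_dilation N1 mA; rewrite normrN1 mul1e.
  have fdil : (EFin \o f) \o dilation (-1) = (fun x => (-1 * f x)%:E).
    by apply/funext => x; rewrite /= /dilation !mulN1r fN.
  rewrite (integral_pushforward mc) ?fdil//.
  exact: (integrableZl measurableT (-1) intf).
by move: E; rewrite RintegralZl//; lra.
Qed.

End dilation.

(** * Scaling, diagonals and Gaussian integrals in several variables *)

Section lebesgue_tuple_integrals.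
Context {R : realType}.
Local Notation Rm := (measurableTypeR R).
Local Notation mu := (@lebesgue_measure R).
Local Notation leb n := (@lebesgue_tuple R n).

Definition tuple_scale n (c : R) (k : n.-tuple Rm) : n.-tuple Rm :=
  [tuple of map (fun x : R => c * x) k].

Lemma measurable_tuple_scale n c : measurable_fun setT (@tuple_scale n c).
Proof. by apply: measurable_tuple_map; exact: mulrl_measurable. Qed.

Lemma tuple_scale_cons n c (v : n.-tuple Rm) (x : R) :
  tuple_scale c (tuple_cons (v, x : Rm)) = tuple_cons (tuple_scale c v, c * x : Rm).
Proof. exact: val_inj. Qed.

Lemma ge0_integral_tuple_scale n (c : R) (f : n.-tuple Rm -> \bar R) : 0 < c ->
  measurable_fun setT f -> (forall k, 0 <= f k)%E ->
  (\int[leb n]_k f k = (c ^+ n)%:E * \int[leb n]_k f (tuple_scale c k))%E.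
Proof.
move=> c0; elim: n f => [|n IHn] f mf f0.
  rewrite expr0 mul1e; apply: eq_integral => k _; congr f.
  by apply: eq_from_tnth => -[].
have ms := @measurable_tuple_scale n.+1 c.
rewrite !ge0_integral_lebesgue_tupleS//; last exact: (measurableT_comp mf ms).
have mfc : measurable_fun setT (f \o @tuple_cons R n).
  by apply: measurableT_comp mf _; exact: measurable_tuple_cons.
have mG : measurable_fun setT (fun v : n.-tuple Rm => \int[mu]_x f (tuple_cons (v, x)))%E.
  by apply: (measurable_fun_fubini_tonelli_F _ mfc) => -[v x]; exact: f0.
rewrite IHn//; last by move=> v; exact: integral_ge0.
rewrite exprSr EFinM -muleA; congr (_ * _)%E.
rewrite -ge0_integralZl//; last 3 first.
- rewrite (_ : (fun v => _) = (fun v =>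
    \int[mu]_x (f \o tuple_scale c) (tuple_cons (v, x)))%E)//.
  apply: (measurable_fun_fubini_tonelli_F (f \o tuple_scale c \o @tuple_cons R n)).
    by apply: measurableT_comp (measurableT_comp mf ms) _; exact: measurable_tuple_cons.
  by move=> -[v x]; exact: f0.
- by move=> v _; exact: integral_ge0.
- by rewrite lee_fin ltW.
apply: eq_integral => v _.
rewrite (@ge0_integral_dilation R c)//; last 2 first.
- by rewrite gt_eqF.
- exact: (measurableT_comp mfc (measurable_pair1 _)).
rewrite gtr0_norm//; congr (_ * _)%E; apply: eq_integral => x _.
by rewrite -tuple_scale_cons.
Qed.

(** Integrability is asked of the scaled function, since that is the one later dominated by a
    multiple of [gaussian_tuple]. Positive and negative parts are scaled separately. *)
Lemma Rintegral_tuple_scale n (c : R) (f : n.-tuple Rm -> R) : 0 < c ->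
  measurable_fun setT f ->
  (leb n).-integrable setT (fun k => (f (tuple_scale c k))%:E) ->
  \int[leb n]_k f k = c ^+ n * \int[leb n]_k f (tuple_scale c k).
Proof.
move=> c0 mf intf.
have mf' : measurable_fun setT (EFin \o f) by exact/measurable_EFinP.
rewrite -RintegralZl// /Rintegral; congr fine.
under [RHS]eq_integral do rewrite EFinM.
rewrite integralZl// integralE [in RHS]integralE.
rewrite (ge0_integral_tuple_scale c0 (measurable_funepos mf'))//.
rewrite (ge0_integral_tuple_scale c0 (measurable_funeneg mf'))//.
pose g (k : n.-tuple Rm) := (f (tuple_scale c k))%:E.
have -> : (\int[leb n]_k (EFin \o f)^\+ (tuple_scale c k) = \int[leb n]_k g^\+ k)%E.
  by apply: eq_integral => k _; rewrite !funeposE.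
have -> : (\int[leb n]_k (EFin \o f)^\- (tuple_scale c k) = \int[leb n]_k g^\- k)%E.
  by apply: eq_integral => k _; rewrite !funenegE.
rewrite -muleN -muleDr//.
by apply: fin_num_adde_defr; exact: (integrable_pos_fin_num measurableT intf).
Qed.

Lemma measurable_tuple_diagonal n (i j : 'I_n) :
  measurable ([set k | tnth k i = tnth k j] : set (n.-tuple Rm)).
Proof.
rewrite (_ : [set k | _] =
  (fun k : n.-tuple Rm => (tnth k i : R) - tnth k j) @^-1` [set 0]).
  rewrite -[X in measurable X]setTI.
  by apply: measurable_funB => //; exact: measurable_tnth.
apply/seteqP; split => k /=; first by move=> ->; rewrite subrr.
by move/eqP; rewrite subr_eq0 => /eqP.
Qed.

(** If the head coordinate is [i] or [j], every section in that coordinate is a single point.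
    Otherwise the condition bears on the tail alone, and the induction hypothesis makes the set of
    bad tails null. *)
Lemma lebesgue_tuple_diagonal n (i j : 'I_n) : i != j ->
  leb n [set k | tnth k i = tnth k j] = 0%E.
Proof.
elim: n i j => [[]//|n IHn] i j ij.
rewrite lebesgue_tupleS /product_measure1.
have [i' ei|ei] := unliftP ord0 i; have [j' ej|ej] := unliftP ord0 j.
- have ij' : i' != j' by apply: contra ij => /eqP e; rewrite ei ej e.
  rewrite (ge0_negligible_integral (measurable_tuple_diagonal i' j') _ _ _
    (IHn _ _ ij'))//; last first.
    apply: measurable_fun_xsection; rewrite -[X in measurable X]setTI.
    by apply: (@measurable_tuple_cons R n) => //; exact: measurable_tuple_diagonal.
  apply: integral0_eq => v [_ /= nv]; rewrite (_ : xsection _ _ = set0) ?measure0//.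
  apply/seteqP; split => x //=; rewrite /xsection/= inE/= ei ej !tnthS => e.
  exact: nv.
- apply: integral0_eq => v _ /=.
  rewrite (_ : xsection _ _ = [set (tnth v i' : R)]) ?lebesgue_measure_set1//.
  apply/seteqP; split => x /=; rewrite /xsection/= inE/= ei ej tnthS.
    by move=> ->.
  by move=> ->.
- apply: integral0_eq => v _ /=.
  rewrite (_ : xsection _ _ = [set (tnth v j' : R)]) ?lebesgue_measure_set1//.
  by apply/seteqP; split => x /=; rewrite /xsection/= inE/= ei ej tnthS => e; exact: e.
- by rewrite ei ej eqxx in ij.
Qed.

Lemma lebesgue_tuple0 : leb 0 setT = 1%E.
Proof. exact: (@diracT _ _ _ ([tuple] : 0.-tuple Rm)). Qed.

Definition gaussian_tuple n (k : n.-tuple Rm) : R := \prod_(i < n) gaussian (tnth k i).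

Definition tuple_sum n (k : n.-tuple Rm) : R := \sum_(i < n) (tnth k i : R).

Lemma gaussian_tuple_cons n (v : n.-tuple Rm) (x : R) :
  gaussian_tuple (tuple_cons (v, x : Rm)) = gaussian x * gaussian_tuple v.
Proof.
rewrite /gaussian_tuple big_ord_recl; congr (_ * _).
by apply: eq_bigr => i _; rewrite tnthS.
Qed.

Lemma tuple_sum_cons n (v : n.-tuple Rm) (x : R) :
  tuple_sum (tuple_cons (v, x : Rm)) = x + tuple_sum v.
Proof.
rewrite /tuple_sum big_ord_recl; congr (_ + _).
by apply: eq_bigr => i _; rewrite tnthS.
Qed.

Lemma gaussian_tuple_ge0 n (k : n.-tuple Rm) : 0 <= gaussian_tuple k.
Proof. by apply: prodr_ge0 => i _; exact: gaussian_ge0. Qed.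

Lemma measurable_gaussian_tuple n : measurable_fun setT (@gaussian_tuple n).
Proof.
apply: measurable_prod => i _.
by apply: measurableT_comp (measurable_tnth _); exact: measurable_gaussian.
Qed.

Lemma measurable_tuple_sum n : measurable_fun setT (@tuple_sum n).
Proof. by apply: measurable_sum => i; exact: measurable_tnth. Qed.

Lemma integral_gaussian_tuple n :
  (\int[leb n]_k (gaussian_tuple k)%:E = (Num.sqrt (2 * pi) ^+ n)%:E)%E.
Proof.
elim: n => [|n IHn].
  rewrite (eq_integral (fun=> 1%E)).
    by rewrite integral_cst// mul1e; exact: lebesgue_tuple0.
  by move=> k _; rewrite /gaussian_tuple big_ord0.
rewrite ge0_integral_lebesgue_tupleS; last 2 first.
- by apply/measurable_EFinP; exact: measurable_gaussian_tuple.
- by move=> k; rewrite lee_fin gaussian_tuple_ge0.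
rewrite (eq_integral (fun v => (Num.sqrt (2 * pi))%:E * (gaussian_tuple v)%:E)%E).
  rewrite ge0_integralZl ?IHn ?exprS//.
  - by apply/measurable_EFinP; exact: measurable_gaussian_tuple.
  - by move=> v _; rewrite lee_fin gaussian_tuple_ge0.
move=> v _; under eq_integral do rewrite gaussian_tuple_cons EFinM.
rewrite ge0_integralZr ?integral_gaussian//.
- by apply/measurable_EFinP; exact: measurable_gaussian.
- by move=> x _; rewrite lee_fin gaussian_ge0.
- by rewrite lee_fin gaussian_tuple_ge0.
Qed.

Lemma integrable_gaussian_tuple n :
  (leb n).-integrable setT (EFin \o @gaussian_tuple n).
Proof.
apply/integrableP; split.
  by apply/measurable_EFinP; exact: measurable_gaussian_tuple.
under eq_integral do rewrite /= ger0_norm ?gaussian_tuple_ge0//.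
by rewrite integral_gaussian_tuple ltry.
Qed.

Lemma integrable_gaussian_tupleM n (h : n.-tuple Rm -> R) (B : R) :
  measurable_fun setT h -> (forall k, `|h k| <= B) ->
  (leb n).-integrable setT (fun k => (gaussian_tuple k * h k)%:E).
Proof.
move=> mh hB.
apply: le_integrable (integrableZl measurableT B (@integrable_gaussian_tuple n)) => //.
  apply/measurable_EFinP; apply: measurable_funM => //.
  exact: measurable_gaussian_tuple.
move=> k _ /=; rewrite lee_fin !normrM mulrC ler_wpM2r//.
by rewrite (le_trans (hB k))// ler_norm.
Qed.

(** The factorization of [exp (i a sum k)] over the coordinates, in real form. The addition formulas
    mix cosine and sine, so both integrals go through one induction; the one-dimensional sine
    integral vanishes by oddness. *)
Lemma gaussian_tuple_fourier n (a : R) :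
  \int[leb n]_k (gaussian_tuple k * cos (a * tuple_sum k)) =
    (Num.sqrt (2 * pi) * gaussian a) ^+ n /\
  \int[leb n]_k (gaussian_tuple k * sin (a * tuple_sum k)) = 0.
Proof.
have mas m : measurable_fun setT (fun k : m.-tuple Rm => a * tuple_sum k).
  by apply: measurable_funM => //; exact: measurable_tuple_sum.
have mc m : measurable_fun setT (fun k : m.-tuple Rm => cos (a * tuple_sum k)).
  apply: measurableT_comp (mas m).
  by apply: continuous_measurable_fun; exact: continuous_cos.
have ms m : measurable_fun setT (fun k : m.-tuple Rm => sin (a * tuple_sum k)).
  apply: measurableT_comp (mas m).
  by apply: continuous_measurable_fun; exact: continuous_sin.
have ic m := integrable_gaussian_tupleM (mc m) (fun k => cos_le1_norm _).
have is_ m := integrable_gaussian_tupleM (ms m) (fun k => sin_le1_norm _).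
have mc1 : measurable_fun [set: R] (fun x : R => cos (a * x)).
  by apply: continuous_measurable_fun; exact: continuous_cosM.
have ms1 : measurable_fun [set: R] (fun x : R => sin (a * x)).
  by apply: continuous_measurable_fun; exact: continuous_sinM.
have ic1 := integrable_gaussianM mc1 (fun x => cos_le1_norm _).
have is1 := integrable_gaussianM ms1 (fun x => sin_le1_norm _).
have sin0_ : \int[mu]_x (gaussian x * sin (a * x)) = 0.
  apply: Rintegral_odd => // x.
  by rewrite /gaussian sqrrN mulrN sinN mulrN.
elim: n => [|n [IHc IHs]].
  split.
    transitivity (\int[leb 0]_k (1 : R)).
      apply: eq_Rintegral => k _.
      by rewrite /gaussian_tuple /tuple_sum !big_ord0 mulr0 cos0 mulr1.
    rewrite Rintegral_cst// mul1r; exact: (congr1 fine lebesgue_tuple0).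
  transitivity (\int[leb 0]_k (0 : R)).
    apply: eq_Rintegral => k _.
    by rewrite /gaussian_tuple /tuple_sum !big_ord0 mulr0 sin0 mulr0.
  by rewrite Rintegral_cst// mul0r.
have EFin_int1 (f : R -> R) : mu.-integrable setT (EFin \o f) ->
    (\int[mu]_x (f x)%:E)%E = (\int[mu]_x f x)%:E.
  by move=> intf; rewrite fineK//; exact: integrable_fin_num.
split.
- rewrite /Rintegral integral_lebesgue_tupleS//.
  rewrite (eq_integral (fun v => (Num.sqrt (2 * pi) * gaussian a *
     (gaussian_tuple v * cos (a * tuple_sum v)))%:E)).
    rewrite -[LHS]/(\int[leb n]_v (Num.sqrt (2 * pi) * gaussian a *
      (gaussian_tuple v * cos (a * tuple_sum v)))).
    by rewrite RintegralZl// IHc exprS.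
  move=> v _; under eq_integral => x _.
    rewrite gaussian_tuple_cons tuple_sum_cons mulrDr cosD.
    rewrite (_ : gaussian x * gaussian_tuple v * _ =
      gaussian_tuple v * cos (a * tuple_sum v) * (gaussian x * cos (a * x)) -
      gaussian_tuple v * sin (a * tuple_sum v) * (gaussian x * sin (a * x))); last by ring.
    over.
  have i1 := integrableZl measurableT (gaussian_tuple v * cos (a * tuple_sum v)) ic1.
  have i2 := integrableZl measurableT (gaussian_tuple v * sin (a * tuple_sum v)) is1.
  rewrite EFin_int1; last exact: (integrableB measurableT i1 i2).
  by rewrite RintegralB// !RintegralZl// gaussian_fourier sin0_ mulr0 subr0 mulrC.
- rewrite /Rintegral integral_lebesgue_tupleS//.
  rewrite (eq_integral (fun v => (Num.sqrt (2 * pi) * gaussian a *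
     (gaussian_tuple v * sin (a * tuple_sum v)))%:E)).
    rewrite -[LHS]/(\int[leb n]_v (Num.sqrt (2 * pi) * gaussian a *
      (gaussian_tuple v * sin (a * tuple_sum v)))).
    by rewrite RintegralZl// IHs mulr0.
  move=> v _; under eq_integral => x _.
    rewrite gaussian_tuple_cons tuple_sum_cons mulrDr sinD.
    rewrite (_ : gaussian x * gaussian_tuple v * _ =
      gaussian_tuple v * cos (a * tuple_sum v) * (gaussian x * sin (a * x)) +
      gaussian_tuple v * sin (a * tuple_sum v) * (gaussian x * cos (a * x))); last by ring.
    over.
  have i1 := integrableZl measurableT (gaussian_tuple v * cos (a * tuple_sum v)) is1.
  have i2 := integrableZl measurableT (gaussian_tuple v * sin (a * tuple_sum v)) ic1.
  rewrite EFin_int1; last exact: (integrableD measurableT i1 i2).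
  by rewrite RintegralD// !RintegralZl// gaussian_fourier sin0_ mulr0 add0r mulrC.
Qed.

End lebesgue_tuple_integrals.

(** * Asymptotics of the moment formula *)

Section complex_functions.
Context {R : realType}.
Implicit Types z w : R[i].
Import complex.ComplexField.Normc.

Lemma ReM z w : complex.Re (z * w) =
  complex.Re z * complex.Re w - complex.Im z * complex.Im w.
Proof. by case: z w => [a b] [c d]. Qed.

Lemma ImM z w : complex.Im (z * w) =
  complex.Re z * complex.Im w + complex.Im z * complex.Re w.
Proof. by case: z w => [a b] [c d]. Qed.

Lemma Re_sum (I : Type) (r : seq I) (P : pred I) (F : I -> R[i]) :
  complex.Re (\sum_(i <- r | P i) F i) = \sum_(i <- r | P i) complex.Re (F i).
Proof. by apply: (big_morph (@complex.Re R)) => // -[a b] [c d]. Qed.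

Lemma norm_Re_le z : `|complex.Re z| <= normc z.
Proof.
case: z => a b /=; rewrite -sqrtr_sqr ler_wsqrtr// lerDl sqr_ge0//.
Qed.

Lemma normc_prod_le1 (I : Type) (r : seq I) (P : pred I) (F : I -> R[i]) :
  (forall i, normc (F i) <= 1) -> normc (\prod_(i <- r | P i) F i) <= 1.
Proof.
move=> F1; elim/big_ind : _ => // [|z w z1 w1]; first by rewrite normc1.
rewrite normcM mulr_ile1//; [case: z {z1}|case: w {w1}] => a b; exact: sqrtr_ge0.
Qed.

Lemma normc_expi (r : R) : normc (expi r) = 1.
Proof. by rewrite /= cos2Dsin2 sqrtr1. Qed.

(** The factor is [(b + i a) / (- b + i a)], that is [(a - i b)^2 / (a^2 + b^2)]. Modulus, scaling,
    measurability and limit are all read off this form. *)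
Lemma u_factorE (theta p q : R) : let a := theta * (p - q) in let b := q * p in
  u_factor theta p q = Complex ((a ^+ 2 - b ^+ 2) / (a ^+ 2 + b ^+ 2))
                               (- (2 * a * b) / (a ^+ 2 + b ^+ 2)).
Proof.
move=> a b; rewrite /u_factor -/a -/b.
have -> : 'i%C * a%:C%C + b%:C%C = Complex b a.
  by apply/eqP; rewrite eq_complex /=; apply/andP; split; apply/eqP; ring.
have -> : 'i%C * a%:C%C - b%:C%C = Complex (- b) a.
  by apply/eqP; rewrite eq_complex /=; apply/andP; split; apply/eqP; ring.
apply/eqP; rewrite eq_complex /= sqrrN [b ^+ 2 + _]addrC.
by apply/andP; split; apply/eqP; ring.
Qed.

Lemma normc_u_factor_le1 (theta p q : R) : normc (u_factor theta p q) <= 1.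
Proof.
rewrite u_factorE /=; set a := theta * _; set b := q * p; set s := a ^+ 2 + b ^+ 2.
have -> : ((a ^+ 2 - b ^+ 2) / s) ^+ 2 + (- (2 * a * b) / s) ^+ 2 = (s / s) ^+ 2.
  by rewrite /s; ring.
(* Division by 0 yields 0, so at [a = b = 0] the modulus is 0; everywhere else it is 1. *)
rewrite sqrtr_sqr; have [->|s0] := eqVneq s 0; first by rewrite mul0r normr0.
by rewrite divff// normr1.
Qed.

(** The numerator and the denominator combine a term linear and a term quadratic in the momenta.
    After removal of [c ^+ 2], the missing power of [c] divides [theta]: this is how a long time
    becomes a large [theta]. *)
Lemma u_factorZ (theta c p q : R) : c != 0 ->
  u_factor theta (c * p) (c * q) = u_factor (theta / c) p q.
Proof.
move=> c0; rewrite !u_factorE; set a' := theta / c * (p - q); set b' := q * p.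
have -> : theta * (c * p - c * q) = c ^+ 2 * a' by rewrite /a'; field.
have -> : c * q * (c * p) = c ^+ 2 * b' by rewrite /b'; ring.
have c40 : c ^+ 4 != 0 by rewrite expf_neq0.
have -> : (c ^+ 2 * a') ^+ 2 + (c ^+ 2 * b') ^+ 2 = c ^+ 4 * (a' ^+ 2 + b' ^+ 2).
  by ring.
have -> : (c ^+ 2 * a') ^+ 2 - (c ^+ 2 * b') ^+ 2 = c ^+ 4 * (a' ^+ 2 - b' ^+ 2).
  by ring.
have -> : - (2 * (c ^+ 2 * a') * (c ^+ 2 * b')) = c ^+ 4 * (- (2 * a' * b')).
  by ring.
by rewrite -!mulf_div divff// !mul1r.
Qed.

Definition cmeasurable d (T : measurableType d) (f : T -> R[i]) :=
  measurable_fun setT (fun x => complex.Re (f x)) /\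
  measurable_fun setT (fun x => complex.Im (f x)).

Lemma cmeasurableM d (T : measurableType d) (f g : T -> R[i]) :
  cmeasurable f -> cmeasurable g -> cmeasurable (fun x => f x * g x).
Proof.
move=> [f1 f2] [g1 g2]; split.
  under eq_fun do rewrite ReM.
  by apply: measurable_funB; apply: measurable_funM.
under eq_fun do rewrite ImM.
by apply: measurable_funD; apply: measurable_funM.
Qed.

Lemma cmeasurable_prod d (T : measurableType d) (I : Type) (r : seq I)
    (P : pred I) (F : I -> T -> R[i]) : (forall i, cmeasurable (F i)) ->
  cmeasurable (fun x => \prod_(i <- r | P i) F i x).
Proof.
move=> mF; elim: r => [|i r IHr].
  by split; under eq_fun do rewrite big_nil; exact: measurable_cst.
case Pi : (P i).
  by under eq_fun do rewrite big_cons Pi; exact: cmeasurableM.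
by under eq_fun do rewrite big_cons Pi.
Qed.

Lemma cmeasurable_expi d (T : measurableType d) (f : T -> R) :
  measurable_fun setT f -> cmeasurable (fun x => expi (f x)).
Proof.
move=> mf; split; apply: measurableT_comp mf; apply: continuous_measurable_fun.
  exact: continuous_cos.
exact: continuous_sin.
Qed.

Lemma measurable_invr : measurable_fun [set: R] (@GRing.inv R).
Proof.
rewrite -(setUv [set (0 : R)]); apply/measurable_funU => //.
  exact: measurableC.
split; first exact: measurable_fun_set1.
apply: open_continuous_measurable_fun.
  by apply: closed_openC; exact: closed_eq.
by move=> x; rewrite inE/= => /eqP x0; exact: inv_continuous.
Qed.

Lemma cmeasurable_u_factor d (T : measurableType d) (theta : R) (f g : T -> R) :
  measurable_fun setT f -> measurable_fun setT g ->
  cmeasurable (fun x => u_factor theta (f x) (g x)).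
Proof.
move=> mf mg.
have ma : measurable_fun setT (fun x => theta * (f x - g x)).
  by apply: measurable_funM => //; exact: measurable_funB.
have mb : measurable_fun setT (fun x => g x * f x) by exact: measurable_funM.
have mV : measurable_fun setT
    (fun x => ((theta * (f x - g x)) ^+ 2 + (g x * f x) ^+ 2)^-1).
  apply: measurableT_comp; first exact: measurable_invr.
  by apply: measurable_funD; exact: measurable_funX.
split; under eq_fun do rewrite u_factorE /=; apply: measurable_funM => //.
  by apply: measurable_funB; exact: measurable_funX.
apply: measurableT_comp => //; apply: measurable_funM => //.
exact: measurable_funM.
Qed.

Definition ccvg (z_ : nat -> R[i]) z :=
  complex.Re (z_ n) @[n --> \oo] --> complex.Re z /\
  complex.Im (z_ n) @[n --> \oo] --> complex.Im z.

Lemma ccvg_cst z : ccvg (fun=> z) z.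
Proof. by split; exact: cvg_cst. Qed.

Lemma ccvgM (z_ w_ : nat -> R[i]) z w : ccvg z_ z -> ccvg w_ w ->
  ccvg (fun n => z_ n * w_ n) (z * w).
Proof.
move=> [z1 z2] [w1 w2]; split.
  by under eq_fun do rewrite ReM; rewrite ReM; apply: (@cvgB R R); apply: (@cvgM R).
by under eq_fun do rewrite ImM; rewrite ImM; apply: (@cvgD R R); apply: (@cvgM R).
Qed.

Lemma ccvg_prod1 (I : eqType) (r : seq I) (P : pred I) (F : nat -> I -> R[i]) :
  (forall i, P i -> ccvg (F ^~ i) 1) -> ccvg (fun n => \prod_(i <- r | P i) F n i) 1.
Proof.
move=> F1; elim: r => [|i r IHr].
  by under eq_fun do rewrite big_nil; exact: ccvg_cst.
case Pi : (P i); last by under eq_fun do rewrite big_cons Pi.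
under eq_fun do rewrite big_cons Pi.
rewrite -[X in ccvg _ X](mulr1 1); apply: ccvgM; [exact: (F1 i Pi)|exact: IHr].
Qed.

Lemma ccvg_u_factor (theta_ : nat -> R) (p q : R) : p != q ->
  theta_ n @[n --> \oo] --> +oo -> ccvg (fun n => u_factor (theta_ n) p q) 1.
Proof.
move=> pq theta_oo.
have pq0 : p - q != 0 by rewrite subr_eq0.
have tpos : \forall n \near \oo, 0 < theta_ n by move/cvgryPgt : (theta_oo); exact.
have invt : (theta_ n)^-1 @[n --> \oo] --> (0 : R).
  exact/gtr0_cvgV0.
(* [r n] is the ratio of the quadratic term to the linear one. It tends to 0 because [p != q], and
   dividing by the linear term expresses the factor through [r n] alone. *)
pose r (n : nat) := (theta_ n)^-1 * (q * p / (p - q)).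
have r0 : r n @[n --> \oo] --> (0 : R).
  by rewrite -[X in _ --> X](mul0r (q * p / (p - q))); apply: cvgMr_tmp.
have r2 : r n ^+ 2 @[n --> \oo] --> (0 : R).
  rewrite [X in _ --> X](_ : 0 = 0 * 0 :> R); last by rewrite mulr0.
  by under eq_fun do rewrite expr2; apply: (@cvgM R).
have rV : (1 + r n ^+ 2)^-1 @[n --> \oo] --> (1 : R).
  rewrite -[X in _ --> X]invr1; apply: cvgV; first exact: oner_neq0.
  by rewrite -[X in _ --> X]addr0; apply: (@cvgD R R) => //; exact: cvg_cst.
have fE n : 0 < theta_ n -> u_factor (theta_ n) p q =
    Complex ((1 - r n ^+ 2) * (1 + r n ^+ 2)^-1) (- (2 * r n) * (1 + r n ^+ 2)^-1).
  move=> t0; rewrite u_factorE /r.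
  set a := theta_ n * (p - q); have a0 : a != 0 by rewrite mulf_neq0// gt_eqF.
  have -> : (theta_ n)^-1 * (q * p / (p - q)) = q * p / a.
    by rewrite /a; field; rewrite pq0 gt_eqF.
  set b := q * p.
  have s0 : a ^+ 2 + b ^+ 2 != 0.
    by rewrite gt_eqF// ltr_pwDl ?sqr_ge0// exprn_even_gt0.
  by congr Complex; field; rewrite ?a0 ?s0 ?andbT.
have near_fE : \forall n \near \oo, Complex ((1 - r n ^+ 2) * (1 + r n ^+ 2)^-1)
    (- (2 * r n) * (1 + r n ^+ 2)^-1) = u_factor (theta_ n) p q.
  by near=> n; rewrite fE//; near: n.
split.
- have : (1 - r n ^+ 2) * (1 + r n ^+ 2)^-1 @[n --> \oo] --> (1 : R).
    rewrite [X in _ --> X](_ : 1 = (1 - 0) * 1 :> R); last by rewrite subr0 mulr1.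
    apply: (@cvgM R) => //; apply: (@cvgB R R) => //; exact: cvg_cst.
  apply: cvg_trans; apply: near_eq_cvg.
  by apply: filterS near_fE => n <-.
- have : - (2 * r n) * (1 + r n ^+ 2)^-1 @[n --> \oo] --> (0 : R).
    rewrite [X in _ --> X](_ : 0 = - (2 * 0) * 1 :> R); last by rewrite mulr0 oppr0 mul0r.
    by apply: (@cvgM R) => //; apply: (@cvgN R R); apply: cvgMl_tmp.
  apply: cvg_trans; apply: near_eq_cvg.
  by apply: filterS near_fE => n <-.
Unshelve. all: end_near. Qed.

End complex_functions.

(** * The oscillatory integral at time 1 as theta grows *)

Section u_moment_asymptotics.
Context {R : realType}.
Local Notation Rm := (measurableTypeR R).
Local Notation leb n := (@lebesgue_tuple R n).
Import complex.ComplexField.Normc.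

Lemma Re_realM (r : R) (z : R[i]) : complex.Re (r%:C%C * z) = r * complex.Re z.
Proof. by case: z => a b /=; rewrite mul0r subr0. Qed.

(** For a start at 0 and a target with equal coordinates, the phase does not depend on the
    permutation: only the sum of the momenta enters. *)
Definition u_term n (theta x : R) (s : 'S_n) (k : n.-tuple Rm) : R[i] :=
  expi (- (x * tuple_sum k)) *
  \prod_(a < n) \prod_(b < n | (a < b)%N && (s b < s a)%N)
    u_factor theta (tnth k (s a)) (tnth k (s b)).

Definition u_amplitude n (theta x : R) (k : n.-tuple Rm) : R :=
  \sum_(s : 'S_n) complex.Re (u_term theta x s k).

Lemma Re_u_integrand n (theta x : R) (k : n.-tuple Rm) :
  complex.Re (u_integrand theta 1 (0 : 'rV_n) (const_mx x) (tnth k)) =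
  gaussian_tuple k * u_amplitude theta x k.
Proof.
rewrite /u_integrand Re_realM Re_sum; congr (_ * _).
  rewrite mul1r -sumrN (big_morph expR (@expRD R) (@expR0 R)).
  by apply: eq_bigr.
apply: eq_bigr => s _; rewrite /u_term; congr (complex.Re (expi _ * _)).
rewrite -mulNr mulr_sumr [RHS](reindex_inj (@perm_inj _ s)).
by apply: eq_bigr => i _; rewrite !mxE; ring.
Qed.

Lemma u_integrand_scale n (theta t x : R) (k : n.-tuple Rm) : 0 < t ->
  u_integrand theta t (0 : 'rV_n) (const_mx (Num.sqrt t * x))
    (tnth (tuple_scale (Num.sqrt t)^-1 k)) =
  u_integrand (theta * Num.sqrt t) 1 (0 : 'rV_n) (const_mx x) (tnth k).
Proof.
move=> t0; have st0 : Num.sqrt t != 0 by rewrite gt_eqF// sqrtr_gt0.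
have tE : t = Num.sqrt t ^+ 2 by rewrite sqr_sqrtr// ltW.
rewrite /u_integrand; congr (_ * _).
  congr (expR (- _))%:C%C; rewrite mul1r mulr_sumr; apply: eq_bigr => i _.
  by rewrite tnth_map {1}tE; field.
apply: eq_bigr => s _; congr (expi _ * _).
  apply: eq_bigr => i _; rewrite !mxE tnth_map; by field.
apply: eq_bigr => a _; apply: eq_bigr => b _.
by rewrite !tnth_map u_factorZ ?invr_eq0// invrK.
Qed.

Lemma normc_u_term_le1 n (theta x : R) (s : 'S_n) (k : n.-tuple Rm) :
  normc (u_term theta x s k) <= 1.
Proof.
rewrite normcM normc_expi mul1r; apply: normc_prod_le1 => a.
by apply: normc_prod_le1 => b; exact: normc_u_factor_le1.
Qed.

Lemma norm_u_amplitude_le n (theta x : R) (k : n.-tuple Rm) :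
  `|u_amplitude theta x k| <= n`!%:R.
Proof.
rewrite (le_trans (ler_norm_sum _ _ _))//.
rewrite (@le_trans _ _ (\sum_(s : 'S_n) 1))//.
  apply: ler_sum => s _; exact: le_trans (norm_Re_le _) (normc_u_term_le1 _ _ _ _).
by rewrite sumr_const card_Sn.
Qed.

Lemma measurable_u_amplitude n (theta x : R) :
  measurable_fun setT (@u_amplitude n theta x).
Proof.
apply: measurable_sum => s.
suff [] : cmeasurable (@u_term n theta x s) by [].
apply: cmeasurableM.
  apply: cmeasurable_expi; apply: measurableT_comp => //.
  by apply: measurable_funM => //; exact: measurable_tuple_sum.
apply: cmeasurable_prod => a; apply: cmeasurable_prod => b.
by apply: cmeasurable_u_factor; exact: measurable_tnth.
Qed.

Lemma u_amplitude_cvg n (theta_ : nat -> R) (x : R) (k : n.-tuple Rm) :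
  theta_ j @[j --> \oo] --> +oo -> (forall a b, a != b -> tnth k a != tnth k b) ->
  u_amplitude (theta_ j) x k @[j --> \oo] --> n`!%:R * cos (x * tuple_sum k).
Proof.
move=> theta_oo kdiff.
have -> : n`!%:R * cos (x * tuple_sum k) =
    \sum_(s : 'S_n) complex.Re (expi (- (x * tuple_sum k))).
  by rewrite sumr_const card_Sn /= cosN mulr_natl.
rewrite /u_amplitude; elim: (index_enum _) => [|s r IHr].
  by under eq_fun do rewrite big_nil; rewrite big_nil; exact: cvg_cst.
under eq_fun do rewrite big_cons; rewrite big_cons; apply: (@cvgD R R) => //.
have : ccvg (fun j => u_term (theta_ j) x s k) (expi (- (x * tuple_sum k)) * 1).
  apply: ccvgM; first exact: ccvg_cst.
  apply: ccvg_prod1 => a _; apply: ccvg_prod1 => b /andP[ab _].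
  apply: ccvg_u_factor => //; apply: kdiff.
  by rewrite (inj_eq perm_inj); apply: contraTneq ab => ->; rewrite ltnn.
by rewrite mulr1 => -[].
Qed.

Lemma ae_lebesgue_tuple_distinct n :
  {ae leb n, forall k, forall a b, a != b -> tnth k a != tnth k b}.
Proof.
have : {ae leb n, forall k, forall p : 'I_n * 'I_n, p.1 != p.2 ->
    tnth k p.1 != tnth k p.2}.
  apply: filter_forall => -[a b] /=; have [->|ab] := eqVneq a b.
    exact: aeW.
  exists [set k | tnth k a = tnth k b]; split.
  - exact: measurable_tuple_diagonal.
  - exact: lebesgue_tuple_diagonal.
  - by move=> k /= /not_implyP[_ /negP]; rewrite negbK => /eqP.
by apply: filterS => k H a b; exact: (H (a, b)).
Qed.

Lemma cvg_integral_u_amplitude n (theta_ : nat -> R) (x : R) :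
  theta_ j @[j --> \oo] --> +oo ->
  \int[leb n]_k (gaussian_tuple k * u_amplitude (theta_ j) x k) @[j --> \oo] -->
  n`!%:R * (Num.sqrt (2 * pi) * gaussian x) ^+ n.
Proof.
move=> theta_oo.
have mcos : measurable_fun setT (fun k : n.-tuple Rm => cos (x * tuple_sum k)).
  apply: measurableT_comp.
    by apply: continuous_measurable_fun; exact: continuous_cos.
  by apply: measurable_funM => //; exact: measurable_tuple_sum.
have icos := integrable_gaussian_tupleM mcos (fun k => cos_le1_norm _).
have [|||||_ _ cvgI] := @dominated_convergence _ _ _ (leb n) setT measurableT
  (fun j k => (gaussian_tuple k * u_amplitude (theta_ j) x k)%:E)
  (fun k => (n`!%:R * (gaussian_tuple k * cos (x * tuple_sum k)))%:E)
  (fun k => (n`!%:R * gaussian_tuple k)%:E).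
- move=> j; apply/measurable_EFinP; apply: measurable_funM.
    exact: measurable_gaussian_tuple.
  exact: measurable_u_amplitude.
- apply/measurable_EFinP; apply: measurable_funM => //.
  by apply: measurable_funM => //; exact: measurable_gaussian_tuple.
- apply: filterS (ae_lebesgue_tuple_distinct n) => k kdiff _.
  apply/fine_cvgP; split; first exact: nearW.
  rewrite mulrCA; apply: cvgMl_tmp; exact: u_amplitude_cvg.
- exact: (integrableZl measurableT n`!%:R (@integrable_gaussian_tuple R n)).
- apply: aeW => k j _; rewrite /= lee_fin normrM ger0_norm ?gaussian_tuple_ge0//.
  by rewrite mulrC ler_wpM2r ?gaussian_tuple_ge0// norm_u_amplitude_le.
have -> : n`!%:R * (Num.sqrt (2 * pi) * gaussian x) ^+ n =
    \int[leb n]_k (n`!%:R * (gaussian_tuple k * cos (x * tuple_sum k))).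
  by rewrite RintegralZl// (gaussian_tuple_fourier n x).1.
apply/fine_cvg.
rewrite fineK; last first.
  exact: (integrable_fin_num measurableT (integrableZl measurableT n`!%:R icos)).
exact: cvgI.
Qed.

Lemma Re_u_moment n (theta t x : R) : 0 < t ->
  complex.Re (u_moment theta t (0 : 'rV_n) (const_mx (Num.sqrt t * x))) =
  ((2 * pi) ^+ n)^-1 * ((Num.sqrt t)^-1 ^+ n *
    \int[leb n]_k (gaussian_tuple k * u_amplitude (theta * Num.sqrt t) x k)).
Proof.
move=> t0; have st0 : 0 < Num.sqrt t by rewrite sqrtr_gt0.
rewrite /u_moment Re_realM; congr (_ * _).
pose f (k : n.-tuple Rm) := complex.Re (u_integrand theta t (0 : 'rV_n)
  (const_mx (Num.sqrt t * x)) (tnth k)).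
pose g (k : n.-tuple Rm) := gaussian_tuple k * u_amplitude (theta * Num.sqrt t) x k.
have fg k : f (tuple_scale (Num.sqrt t)^-1 k) = g k.
  by rewrite /f u_integrand_scale// Re_u_integrand.
have mg : measurable_fun setT g.
  apply: measurable_funM; first exact: measurable_gaussian_tuple.
  exact: measurable_u_amplitude.
(* Undoing the scaling yields the measurability of [f] from that of [g]. *)
have fE : f = g \o @tuple_scale R n (Num.sqrt t).
  apply/funext => k; rewrite /= -fg; congr f.
  by apply: eq_from_tnth => i; rewrite !tnth_map mulKf// gt_eqF.
have mf : measurable_fun setT f.
  by rewrite fE; apply: measurableT_comp mg _; exact: measurable_tuple_scale.
rewrite -[LHS]/(\int[leb n]_k f k) (@Rintegral_tuple_scale R n (Num.sqrt t)^-1)//.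
- by congr (_ * _); apply: eq_Rintegral => k _; rewrite fg.
- by rewrite invr_gt0.
- under eq_fun do rewrite fg.
  apply: integrable_gaussian_tupleM; first exact: measurable_u_amplitude.
  by move=> k; exact: norm_u_amplitude_le.
Qed.

End u_moment_asymptotics.

(** * Moments of the rescaled measures *)

Section rescaled_moments.
Context {R : realType}.
Local Notation Rm := (measurableTypeR R).
Local Notation leb n := (@lebesgue_tuple R n).
Local Notation D := (`[0%R, +oo[%classic : set Rm).

(** A single point has no inversions, hence no dependence on [theta]. This makes the total mass
    exact at every time and not merely in the limit. *)
Lemma u_amplitude1 (theta x : R) (k : 1.-tuple Rm) :
  u_amplitude theta x k = cos (x * tuple_sum k).
Proof.
have noinv (s : 'S_1) : u_term theta x s k = expi (- (x * tuple_sum k)).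
  rewrite /u_term big1 ?mulr1// => a _; rewrite big1// => b /andP[].
  by rewrite [a]ord1 [b]ord1.
rewrite /u_amplitude (eq_bigr (fun=> cos (x * tuple_sum k))).
  by rewrite sumr_const card_Sn.
by move=> s _; rewrite noinv /= cosN.
Qed.

Lemma cvgy_scale_sqrt (theta : R) (u : nat -> R) : 0 < theta ->
  u j @[j --> \oo] --> +oo -> theta * Num.sqrt (u j) @[j --> \oo] --> +oo.
Proof.
move=> theta0 /cvgryPgt u_oo; apply/cvgryPgt => A.
have := u_oo ((A / theta) ^+ 2); apply: filterS => j uj.
rewrite -ltr_pdivrMl// mulrC (le_lt_trans (ler_norm _))//.
by rewrite -sqrtr_sqr ltr_sqrt// (le_lt_trans _ uj)// sqr_ge0.
Qed.

Variables (theta : {posnum R}) (wgamma : R -> R.-ftker Rm ~> Rm).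
Hypothesis wgamma_nneg : forall t y : R, 0 < t -> wgamma t y `]-oo, 0[%classic = 0%E.
Hypothesis wgamma_moments : forall t : R, 0 < t ->
  moment_identities theta%:num t (wgamma t).
Variable x : R.

Let fourier_integral n t :=
  \int[leb n]_k (gaussian_tuple k * u_amplitude (theta%:num * Num.sqrt t) x k).

(** It is free of [t]: the normalization brings [sqrt t], the dilation [sqrt t ^ n], and the change
    of variables their inverse [sqrt t ^ - n.+1]. *)
Definition moment_prefactor n : R :=
  Num.sqrt (2 * pi) * expR (x ^+ 2 / 2) / n.+1%:R / theta%:num ^+ n /
  (2 * pi) ^+ n.+1.

(** The identity of index [n.+1] is the one for moment [n], because [wgamma] already contains a
    factor [w]. The moment is real, so comparing real parts is enough. *)
Lemma wgamma_momentE (t : R) n : 0 < t ->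
  (\int[wgamma t (Num.sqrt t * x)%R]_w ((w : R) ^+ n)%:E =
   (n.+1%:R^-1 * theta%:num^-1 ^+ n * (((2 * pi) ^+ n.+1)^-1 *
     ((Num.sqrt t)^-1 ^+ n.+1 * fourier_integral n.+1 t)))%:E)%E.
Proof.
move=> t0; have [r -> rE] := wgamma_moments t0 (Num.sqrt t * x) (ltn0Sn n).
congr EFin; rewrite -(Re_u_moment n.+1 theta%:num x t0) -Re_realM.
rewrite -[r]/(complex.Re r%:C%C) rE; congr (complex.Re (_ * _)).
by rewrite rmorphM/= rmorphXn/= !fmorphV rmorph_nat.
Qed.

Lemma rescaled_moment (t : R) n : 0 < t ->
  (\int[rescaled_measure wgamma t x]_(w in D) ((w : R) ^+ n)%:E =
   (moment_prefactor n * fourier_integral n.+1 t)%:E)%E.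
Proof.
move=> t0; have st0 : 0 < Num.sqrt t by rewrite sqrtr_gt0.
have mX : measurable_fun [set: Rm] (fun w : R => ((w : R) ^+ n)%:E).
  by apply/measurable_EFinP; exact: exprn_measurable.
have Xge0 (w : R) : D w -> (0 <= (w ^+ n)%:E)%E.
  by rewrite /= in_itv/= andbT => w0; rewrite lee_fin exprn_ge0.
have mdil := @measurable_dilation R (Num.sqrt t).
rewrite (ge0_integral_pushforward mdil)//; last 2 first.
- exact: measurable_funTS.
- by move=> w; rewrite inE => /Xge0.
have -> : dilation (Num.sqrt t) @^-1` D = D.
  by apply/seteqP; split => w /=; rewrite /dilation !in_itv/= !andbT pmulr_rge0.
rewrite ge0_integral_mscale//; last 2 first.
- by apply: measurable_funTS; exact: measurableT_comp mX mdil.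
- move=> w Dw; apply: Xge0; move: Dw.
  by rewrite /= /dilation !in_itv/= !andbT pmulr_rge0.
under eq_integral do rewrite /dilation/= exprMn EFinM.
rewrite ge0_integralZl//; last exact: measurable_funTS.
(* The moment identities integrate over the whole line, while the steps above need nonnegative
   powers and hence [D]; the absence of mass on negative numbers reconciles the two. *)
rewrite -integral_nonneg_supported//; last 2 first.
- exact: wgamma_nneg.
- exact: exprn_continuous.
rewrite wgamma_momentE// -!EFinM; congr EFin.
rewrite /moment_prefactor /= sqrtrM ?mulr_ge0 ?pi_ge0//.
have st00 : Num.sqrt t != 0 by rewrite gt_eqF.
have p0 : (2 * pi : R) != 0 by rewrite mulf_neq0// gt_eqF// pi_gt0.
rewrite !exprVn (exprS (Num.sqrt t)).
have : (2 * pi) ^+ n.+1 != 0 :> R by rewrite expf_neq0.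
have : theta%:num ^+ n != 0 :> R by rewrite expf_neq0// gt_eqF.
have : Num.sqrt t ^+ n != 0 by rewrite expf_neq0.
have : n.+1%:R != 0 :> R by rewrite pnatr_eq0.
move: (expR _) (_ ^+ n.+1) (theta%:num ^+ n) (Num.sqrt t ^+ n) n.+1%:R (fourier_integral _ _).
by move=> e a b c' N J N0 c0 b0 a0; field; rewrite st00 N0 c0 b0 a0.
Qed.

Lemma rescaled_nneg (t : R) : 0 < t ->
  rescaled_measure wgamma t x `]-oo, 0[%classic = 0%E.
Proof.
move=> t0; have st0 : 0 < Num.sqrt t by rewrite sqrtr_gt0.
rewrite /rescaled_measure /image_measure /pushforward /= /mscale /=.
have -> : dilation (Num.sqrt t) @^-1` `]-oo, 0[ = `]-oo, 0[%classic.
  by apply/seteqP; split => w /=; rewrite /dilation !in_itv/= pmulr_rlt0.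
by rewrite wgamma_nneg// mule0.
Qed.

(** The mass is the moment of order 0. Its Fourier integral is exactly [sqrt (2 pi) * gaussian x],
    which [moment_prefactor 0] inverts. *)
Lemma rescaled_setT (t : R) : 0 < t -> rescaled_measure wgamma t x setT = 1%E.
Proof.
move=> t0; rewrite -[LHS]mul1e -integral_cst//.
rewrite -[LHS]/(\int[rescaled_measure wgamma t x]_w ((w : R) ^+ 0)%:E)%E.
rewrite integral_nonneg_supported; [|exact: rescaled_nneg|exact: exprn_continuous].
rewrite rescaled_moment//; congr EFin.
rewrite /fourier_integral.
under eq_Rintegral do rewrite u_amplitude1.
rewrite (gaussian_tuple_fourier 1 x).1 /moment_prefactor /gaussian expRN.
have e0 : expR (x ^+ 2 / 2) != 0 by rewrite gt_eqF// expR_gt0.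
have s0 : Num.sqrt (2 * pi) != 0 :> R by rewrite gt_eqF// sqrtr_gt0 mulr_gt0// pi_gt0.
have -> : (2 * pi) ^+ 1 = Num.sqrt (2 * pi) ^+ 2 :> R.
  by rewrite sqr_sqrtr// mulr_ge0// pi_ge0.
by move: e0 s0; move: (expR _) (Num.sqrt _) => e s e0 s0; field; rewrite e0 s0.
Qed.

Lemma integrable_rescaled_moment (t : R) k : 0 < t ->
  (rescaled_measure wgamma t x).-integrable D (fun w : R => (w ^+ k)%:E).
Proof.
move=> t0; apply/integrableP; split.
  by apply/measurable_EFinP/measurable_funTS; exact: exprn_measurable.
rewrite (eq_integral (fun w : Rm => ((w : R) ^+ k)%:E)).
  by rewrite rescaled_moment// ltry.
by move=> w; rewrite inE/= in_itv/= andbT => w0; rewrite ger0_norm ?exprn_ge0.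
Qed.

Lemma rescaled_moment_cvg n :
  \int[rescaled_measure wgamma t x]_(w in D) ((w : R) ^+ n) @[t --> +oo] -->
  n`!%:R / (theta%:num * Num.sqrt (2 * pi) * expR (x ^+ 2 / 2)) ^+ n.
Proof.
have sp0 : Num.sqrt (2 * pi) != 0 :> R by rewrite gt_eqF// sqrtr_gt0 mulr_gt0// pi_gt0.
have p2 : 2 * pi = Num.sqrt (2 * pi) ^+ 2 :> R by rewrite sqr_sqrtr// mulr_ge0// pi_ge0.
have lim : moment_prefactor n * fourier_integral n.+1 t @[t --> +oo] -->
    moment_prefactor n * (n.+1`!%:R * (Num.sqrt (2 * pi) * gaussian x) ^+ n.+1).
  (* Dominated convergence concerns sequences, so the limit in [t] is taken along an arbitrary
     sequence tending to [+oo]. *)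
  apply: cvgMl_tmp; apply/cvg_pinftyP => u u_oo.
  by apply: cvg_integral_u_amplitude; exact: cvgy_scale_sqrt.
(* The prefactor contains [n.+1^-1], which turns [n.+1!] into [n!]; its
   [sqrt (2 pi) * expR (x ^+ 2 / 2)] lowers the power [n.+1] to [n]. *)
have -> : n`!%:R / (theta%:num * Num.sqrt (2 * pi) * expR (x ^+ 2 / 2)) ^+ n =
    moment_prefactor n * (n.+1`!%:R * (Num.sqrt (2 * pi) * gaussian x) ^+ n.+1).
  have p2n : (2 * pi) ^+ n.+1 = Num.sqrt (2 * pi) ^+ n.+1 * Num.sqrt (2 * pi) ^+ n.+1 :> R.
    by rewrite {1}p2 exprMn.
  have e0 : expR (x ^+ 2 / 2) != 0 by rewrite gt_eqF// expR_gt0.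
  rewrite /moment_prefactor p2n /gaussian expRN factS natrM !exprMn exprVn !(exprS _ n).
  have : theta%:num ^+ n != 0 :> R by rewrite expf_neq0// gt_eqF.
  have : Num.sqrt (2 * pi) ^+ n != 0 :> R by rewrite expf_neq0.
  have : expR (x ^+ 2 / 2) ^+ n != 0 by rewrite expf_neq0.
  have : n.+1%:R != 0 :> R by rewrite pnatr_eq0.
  move: e0 sp0; move: (expR _) (Num.sqrt _) => e r.
  move: (e ^+ n) (r ^+ n) (theta%:num ^+ n) n.+1%:R n`!%:R.
  by move=> en rn c1 N f e0 r0 N0 en0 rn0 c0; field; rewrite ?e0 ?r0 ?N0 ?en0 ?rn0 ?c0.
apply: cvg_trans lim; apply: near_eq_cvg; near=> t.
by rewrite /Rintegral rescaled_moment//; near: t; exact: nbhs_pinfty_gt.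
Unshelve. all: end_near. Qed.

End rescaled_moments.

Theorem proposition5p4 (R : realType) (theta : {posnum R})
  (d : measure_display) (Omega : measurableType d) (P : probability Omega R)
  (K : R -> R -> Omega -> R -> probability (measurableTypeR R) R)
  (hK : howitt_warren_flow P K (characteristic_measure theta) 0)
  (gamma : R -> R.-ker (measurableTypeR R) ~> (measurableTypeR R))
  (wgamma : R -> R.-ftker (measurableTypeR R) ~> (measurableTypeR R))
  (hgamma : forall t : R, 0 < t ->
     disintegrates (atom_intensity P (hw_process K t)) (gamma t))
  (hwgamma : forall t : R, 0 < t -> weighted_version (gamma t) (wgamma t))
  (hmoments : forall t : R, 0 < t ->
     moment_identities theta%:num t (wgamma t))
  (x : R) :
  (forall t : R, 0 < t -> rescaled_measure wgamma t x setT = 1%E) /\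
  weak_cvg +oo (fun t : R => rescaled_measure wgamma t x)
    (exponential_prob (theta%:num * Num.sqrt (2 * pi) * expR (x ^+ 2 / 2))).
Proof.
have wgamma_nneg (t y : R) : 0 < t -> wgamma t y `]-oo, 0[%classic = 0%E.
  by move=> t0; have [H _] := hwgamma t t0; exact: H.
split; first by move=> t t0; exact: (rescaled_setT wgamma_nneg hmoments).
apply: moment_cvg_weak_cvg_exponential.
- by rewrite !mulr_gt0 ?expR_gt0// sqrtr_gt0 mulr_gt0// pi_gt0.
- near=> t; apply: (rescaled_nneg wgamma_nneg).
  by near: t; exact: nbhs_pinfty_gt.
- move=> k; near=> t; apply: (integrable_rescaled_moment wgamma_nneg hmoments).
  by near: t; exact: nbhs_pinfty_gt.
- by move=> k; exact: (rescaled_moment_cvg wgamma_nneg hmoments).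
Unshelve. all: end_near. Qed.
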